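(* Let $X$ be a complex infinite-dimensional Banach space, let $\mathcal{I}$ be a closed, non-zero ideal of operators contained in the ideal $\mathcal{S}$ of strictly singular operators, and consider the short exact sequence $$\Sigma_X:\quad \{0\}\longrightarrow\mathcal{I}(X)\xrightarrow{\ \iota\ }\mathcal{B}(X)\xrightarrow{\ \pi\ }\mathcal{B}(X)/\mathcal{I}(X)\longrightarrow\{0\},$$ where $\iota$ is the inclusion and $\pi$ the quotient map. (i) Suppose that $\Sigma_X$ splits algebraically. Then $K_0(\mathcal{B}(X))$ contains a subgroup isomorphic to $\mathbb{Z}$. In particular, $\Sigma_X$ never splits algebraically in the case where $K_0(\mathcal{B}(X))=\{0\}$. (ii) Suppose that there exists $m\in\mathbb{N}$ for which $X^m$ is linearly homeomorphic to one of its proper, closed subspaces of finite codimension, or, equivalently, there exists $m\in\mathbb{N}$ for which $X^m$ admits a Fredholm operator of non-zero index. Then $\Sigma_X$ does not split algebraically.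
   Context: All Banach spaces are complex and infinite-dimensional; $\mathcal{B}(X,Y)$ is the Banach space of continuous linear maps $X\to Y$ and $\mathcal{B}(X)=\mathcal{B}(X,X)$. $X^m$ is the direct sum of $m$ copies of $X$. An ideal of operators $\mathcal{I}$ assigns to each pair $(X,Y)$ of Banach spaces a subspace $\mathcal{I}(X,Y)$ of $\mathcal{B}(X,Y)$ such that $TSR\in\mathcal{I}(W,Z)$ whenever $R\in\mathcal{B}(W,X)$, $S\in\mathcal{I}(X,Y)$, $T\in\mathcal{B}(Y,Z)$; write $\mathcal{I}(X)=\mathcal{I}(X,X)$. It is closed if every $\mathcal{I}(X,Y)$ is norm-closed, non-zero if $\mathcal{I}(X,Y)\neq\{0\}$ for all $X,Y$, and contained in $\mathcal{J}$ if $\mathcal{I}(X,Y)\subseteq\mathcal{J}(X,Y)$ for all $X,Y$. An operator $S:X\to Y$ is strictly singular ($S\in\mathcal{S}(X,Y)$) if every subspace of $X$ on which $S$ is bounded below is finite-dimensional. A short exact sequence of algebras $\{0\}\to A\xrightarrow{\varphi}B\xrightarrow{\psi}C\to\{0\}$ splits algebraically if there is an algebra homomorphism $\theta:C\to B$ (not required to be continuous) with $\psi\circ\theta=\operatorname{id}_C$. $K_0$: for a unital algebra $A$, let $\operatorname{IP}_n(A)$ be the set of idempotents in $M_n(A)$ and $\operatorname{IP}_\infty(A)=\bigcup_{n\ge1}\operatorname{IP}_n(A)$. For $P\in\operatorname{IP}_m(A)$, $Q\in\operatorname{IP}_n(A)$, $P\sim_0Q$ means $P=RT$, $Q=TR$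 for some $R\in M_{m,n}(A)$, $T\in M_{n,m}(A)$. $K_0(A)$ is the Grothendieck group of the semigroup $\operatorname{IP}_\infty(A)/{\sim_0}$ with addition $[P]+[Q]=[\operatorname{diag}(P,Q)]$. *)

(* Defs.v *)
From HB Require Import structures.
From mathcomp Require Import all_boot all_order all_algebra.
From mathcomp Require Import generic_quotient ring_quotient complex.
From mathcomp Require Import all_classical all_reals all_analysis.

Set Implicit Arguments.
Unset Strict Implicit.
Unset Printing Implicit Defensive.

Import Order.TTheory GRing.Theory Num.Theory.
Import numFieldNormedType.Exports.

Local Open Scope classical_set_scope.
Local Open Scope ring_scope.
Local Open Scope quotient_scope.

Section Dimension.
Context {K : fieldType} {V : lmodType K}.
Implicit Types U W : set V.

Definition linear_subspace U :=
  U 0 /\ forall a u v, U u -> U v -> U (a *: u + v).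

(* The classes of e_0, ..., e_(n-1) form a basis of U / W, where W is a
   subspace of U; uniqueness of the coordinates is linear independence. *)
Definition has_dim_mod U W n := exists e : 'I_n -> V,
  (forall i, U (e i)) /\
  forall u, U u -> exists! c : 'rV[K]_n, W (u - \sum_i c 0 i *: e i).

Definition has_dim U n := has_dim_mod U [set 0] n.
Definition finite_dim U := exists n, has_dim U n.
Definition has_codim W n := has_dim_mod [set: V] W n.
Definition finite_codim W := exists n, has_codim W n.

Lemma finite_dim_trivial : (forall v : V, v = 0) -> finite_dim [set: V].
Proof.
move=> V0; exists 0%N, (fun=> 0); split=> // u _; exists 0; split.
  by rewrite (V0 (_ - _)).
by move=> c _; apply/rowP; case.
Qed.

End Dimension.

(* Operators are a subtype of the functions X -> Y, so that equality of
   operators is extensional and the vector space structure is inherited. *)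
Section BoundedOperators.
Context {R : realType} {X Y : normedModType R[i]}.

Definition is_bop : {pred X -> Y} :=
  [pred f : X -> Y | `[< linear f /\ continuous f >]].

Record bop := Bop { bop_fun :> X -> Y; _ : bop_fun \in is_bop }.

HB.instance Definition _ := [isSub for bop_fun].
HB.instance Definition _ := [Choice of bop by <:].

Lemma bop_linear (T : bop) : linear T.
Proof. by case: T => f /= /asboolP[]. Qed.

Lemma bop_continuous (T : bop) : continuous T.
Proof. by case: T => f /= /asboolP[]. Qed.

HB.instance Definition _ (T : bop) :=
  GRing.isLinear.Build R[i] X Y _ T (bop_linear T).

Lemma bopP (S T : bop) : S =1 T -> S = T.
Proof. by move=> /funext ST; apply: val_inj. Qed.

Lemma is_bop_submod : submod_closed is_bop.
Proof.
split.
  apply/asboolP; split; last by move=> x; exact: cst_continuous.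
  by move=> a u v; rewrite /= scaler0 addr0.
move=> a f g /asboolP[lf cf] /asboolP[lg cg]; apply/asboolP; split.
  move=> b u v; rewrite !fctE /= lf lg !scalerDr !scalerA mulrC.
  by rewrite !addrA; congr (_ + _); rewrite addrAC.
by move=> x; apply: continuousD; [apply: continuousZr; exact: cf | exact: cg].
Qed.

HB.instance Definition _ :=
  GRing.isSubmodClosed.Build R[i] (X -> Y) is_bop is_bop_submod.
HB.instance Definition _ := [SubChoice_isSubLmodule of bop by <:].

End BoundedOperators.
Arguments bop {R} X Y.
Section OperatorNorm.
Context {R : realType} {X Y : normedModType R[i]}.
Implicit Types S T : bop X Y.
Local Open Scope complex_scope.

(* Norms are R[i]-valued, but have zero imaginary part. *)
Definition rnorm {Z : normedModType R[i]} (z : Z) : R := complex.Re `|z|.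

Lemma rnormE {Z : normedModType R[i]} (z : Z) : (rnorm z)%:C = `|z|.
Proof. by rewrite /rnorm RRe_real. Qed.

Lemma rnorm_ge0 {Z : normedModType R[i]} (z : Z) : 0 <= rnorm z.
Proof. by rewrite -lecR rmorph0 rnormE normr_ge0. Qed.

Lemma le0C (x : R) : (0 <= x%:C :> R[i]) = (0 <= x).
Proof. by rewrite -lecR rmorph0. Qed.

Definition op_norm T : R := sup [set rnorm (T x) | x in [set x | `|x| <= 1]].

Lemma op_norm_has_sup T : has_sup [set rnorm (T x) | x in [set x | `|x| <= 1]].
Proof.
split; first by exists (rnorm (T 0)), 0 => //=; rewrite normr0.
have /linear_boundedP[M [Mr MT]] : bounded_near T (nbhs (0 : X)).
  exact/linear_bounded_continuous/bop_continuous.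
have {}MT : forall x, `|T x| <= (M + 1) * `|x| by apply: MT; rewrite ltrDl.
exists (complex.Re (`|M| + 1)) => _ [x x1 <-]; have {}x1 : `|x| <= 1 by [].
rewrite -lecR rnormE RRe_real ?ger0_real ?addr_ge0//.
apply: le_trans (MT x) _; apply: (@le_trans _ _ ((`|M| + 1) * `|x|)).
  by rewrite ler_wpM2r// lerD2r real_ler_norm.
by rewrite ler_piMr// addr_ge0.
Qed.

Lemma op_norm_ge0 T : 0 <= op_norm T.
Proof.
apply: (le_trans (rnorm_ge0 (T 0))); apply: (ub_le_sup (op_norm_has_sup T).2).
by exists 0 => //=; rewrite normr0.
Qed.

Lemma le_op_norm T x : `|T x| <= (op_norm T)%:C * `|x|.
Proof.
have [->|x0] := eqVneq x 0; first by rewrite linear0 !normr0 mulr0.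
have nx : 0 < `|x| by rewrite normr_gt0.
rewrite -ler_pdivrMr// mulrC.
have -> : `|x|^-1 * `|T x| = `|T (`|x|^-1 *: x)|.
  by rewrite linearZ normrZ ger0_norm// invr_ge0.
rewrite -rnormE lecR; apply: (ub_le_sup (op_norm_has_sup T).2).
exists (`|x|^-1 *: x) => //=.
by rewrite normrZ ger0_norm ?invr_ge0// mulVf// normr_eq0.
Qed.

Lemma op_norm_le T (M : R) :
  (forall x, `|x| <= 1 -> `|T x| <= M%:C) -> op_norm T <= M.
Proof.
move=> TM; apply: ge_sup; first exact: (op_norm_has_sup T).1.
by move=> _ [x /= /TM x1 <-]; rewrite -lecR rnormE.
Qed.

Lemma op_normD S T :
  (op_norm (S + T))%:C <= (op_norm S)%:C + (op_norm T)%:C.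
Proof.
rewrite -rmorphD lecR; apply: op_norm_le => x x1.
rewrite rmorphD; apply: le_trans (ler_normD (S x) (T x)) _.
rewrite lerD//; apply: le_trans (le_op_norm _ x) _.
  by rewrite ler_piMr// le0C op_norm_ge0.
by rewrite ler_piMr// le0C op_norm_ge0.
Qed.

Lemma op_norm_leZ (l : R[i]) T : (op_norm (l *: T))%:C <= `|l| * (op_norm T)%:C.
Proof.
have [r lr] : exists r : R, `|l| = r%:C.
  by exists (complex.Re `|l|); rewrite RRe_real.
rewrite lr -rmorphM lecR; apply: op_norm_le => x x1.
rewrite rmorphM /= -lr.
rewrite [X in `|X|](_ : _ = l *: T x)// normrZ ler_wpM2l//.
apply: le_trans (le_op_norm _ x) _.
by rewrite ler_piMr// le0C op_norm_ge0.
Qed.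

Lemma op_normZ (l : R[i]) T : (op_norm (l *: T))%:C = `|l| * (op_norm T)%:C.
Proof.
apply/eqP; rewrite eq_le op_norm_leZ/=.
have [->|l0] := eqVneq l 0.
  by rewrite normr0 mul0r le0C op_norm_ge0.
rewrite -ler_pdivlMl ?normr_gt0// -normfV.
by apply: le_trans (op_norm_leZ _ _); rewrite scalerA mulVf// scale1r.
Qed.

Lemma op_norm0_eq0 T : (op_norm T)%:C = 0 -> T = 0.
Proof.
move=> T0; apply: bopP => x; apply/eqP; rewrite -normr_le0.
by apply: le_trans (le_op_norm T x) _; rewrite T0 mul0r.
Qed.

HB.instance Definition _ := Lmodule_isNormed.Build R[i] (bop X Y)
  op_normD op_normZ op_norm0_eq0.

End OperatorNorm.

Section Composition.
Context {R : realType} {X Y Z : normedModType R[i]}.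

Lemma is_bop_comp (T : bop Y Z) (S : bop X Y) : T \o S \in is_bop.
Proof.
apply/asboolP; split; first by move=> a u v; rewrite /= !linearP.
move=> x; apply: continuous_comp; exact: bop_continuous.
Qed.

Definition bop_comp (T : bop Y Z) (S : bop X Y) : bop X Z :=
  Bop (is_bop_comp T S).

End Composition.

Record banach (R : realType) := Banach {
  banach_space :> completeNormedModType R[i];
  banach_infinite_dim : ~ finite_dim [set: banach_space]
}.

Section OperatorAlgebra.
Context {R : realType} (X : banach R).
Implicit Types S T U : bop X X.

Lemma is_bop_id : (id : X -> X) \in is_bop.
Proof. by apply/asboolP; split=> // x; exact: cvg_id. Qed.

Definition bop_id : bop X X := Bop is_bop_id.

Lemma bop_compA : associative (@bop_comp R X X X).
Proof. by move=> S T U; apply: bopP. Qed.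

Lemma bop_comp1l : left_id bop_id (@bop_comp R X X X).
Proof. by move=> S; apply: bopP. Qed.

Lemma bop_comp1r : right_id bop_id (@bop_comp R X X X).
Proof. by move=> S; apply: bopP. Qed.

Lemma bop_compDl : left_distributive (@bop_comp R X X X) +%R.
Proof. by move=> S T U; apply: bopP. Qed.

Lemma bop_compDr : right_distributive (@bop_comp R X X X) +%R.
Proof. by move=> S T U; apply: bopP => x /=; exact: linearD. Qed.

Lemma bop_id_neq0 : bop_id != 0.
Proof.
apply/eqP => id0; apply: (@banach_infinite_dim R X).
apply: finite_dim_trivial => v; exact: (congr1 (fun T : bop X X => T v) id0).
Qed.

HB.instance Definition _ := GRing.Zmodule_isNzRing.Build (bop X X)
  bop_compA bop_comp1l bop_comp1r bop_compDl bop_compDr bop_id_neq0.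

Lemma bop_scaleAl (a : R[i]) (S T : bop X X) : a *: (S * T) = (a *: S) * T.
Proof. by apply: bopP. Qed.

Lemma bop_scaleAr (a : R[i]) (S T : bop X X) : a *: (S * T) = S * (a *: T).
Proof. by apply: bopP => x /=; apply/esym; exact: linearZ. Qed.

HB.instance Definition _ := GRing.Lmodule_isLalgebra.Build R[i] (bop X X)
  bop_scaleAl.
HB.instance Definition _ := GRing.Lalgebra_isAlgebra.Build R[i] (bop X X)
  bop_scaleAr.

End OperatorAlgebra.

Section DirectPower.
Context {K : numFieldType}.

(* X^m with the sum norm; any of the usual norms gives the same topology. *)
Definition power (X : normedModType K) (m : nat) : Type := {ffun 'I_m -> X}.

Section Norm.
Context {X : normedModType K} {m : nat}.
HB.instance Definition _ := GRing.Lmodule.on (power X m).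

Definition power_norm (x : power X m) : K := \sum_i `|x i|.

Lemma power_normD (x y : power X m) :
  power_norm (x + y) <= power_norm x + power_norm y.
Proof.
by rewrite -big_split; apply: ler_sum => i _; rewrite ffunE ler_normD.
Qed.

Lemma power_normZ (l : K) (x : power X m) :
  power_norm (l *: x) = `|l| * power_norm x.
Proof. by rewrite mulr_sumr; apply: eq_bigr => i _; rewrite ffunE normrZ. Qed.

Lemma power_norm0_eq0 (x : power X m) : power_norm x = 0 -> x = 0.
Proof.
move=> /eqP; rewrite psumr_eq0// => /allP x0; apply/ffunP => i; apply/eqP.
by rewrite ffunE -normr_eq0; apply: (implyP (x0 i _)) => //; rewrite mem_index_enum.
Qed.

HB.instance Definition _ := Lmodule_isNormed.Build K (power X m)
  power_normD power_normZ power_norm0_eq0.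

Lemma power_normE (x : power X m) : `|x| = \sum_i `|x i|. Proof. by []. Qed.

Lemma le_power_norm (x : power X m) i : `|x i| <= `|x|.
Proof. by rewrite power_normE (bigD1 i)//= lerDl sumr_ge0. Qed.

End Norm.

Section Complete.
Context {X : completeNormedModType K} {m : nat}.

Lemma power_complete (F : set_system (power X m)) :
  ProperFilter F -> cauchy F -> cvg F.
Proof.
move=> FF Fc.
have Fi i : cvg ((fun x : power X m => x i) @ F).
  apply: cauchy_cvg; apply/cauchyP => e e0.
  have /cauchyP/(_ e e0)[x Fx] := Fc.
  exists (x i); rewrite /= nbhs_simpl; apply: (filterS _ Fx) => y /=.
  rewrite -!ball_normE /=.
  by apply: le_lt_trans; have := le_power_norm (x - y) i; rewrite !ffunE.
pose l : power X m := [ffun i => lim ((fun x : power X m => x i) @ F)].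
apply/cvg_ex; exists l; apply/cvgrPdist_lt => e e0.
have em : 0 < e / m.+1%:R by rewrite divr_gt0.
have : F [set x : power X m | forall i, `|l i - x i| < e / m.+1%:R].
  apply: (@filter_forall _ _ (fun i (x : power X m) =>
    `|l i - x i| < e / m.+1%:R)) => i.
  by have /cvgrPdist_lt/(_ _ em) := Fi i; rewrite ffunE.
apply: filterS => x lx; rewrite power_normE.
apply: (@le_lt_trans _ _ (\sum_(i < m) e / m.+1%:R)).
  by apply: ler_sum => i _; rewrite !ffunE; have := lx i; rewrite ffunE => /ltW.
rewrite sumr_const card_ord -[X in X < _]mulr_natr mulrAC ltr_pdivrMr//.
by rewrite ltr_pM2l// ltr_nat.
Qed.

HB.instance Definition _ := Uniform_isComplete.Build (power X m) power_complete.

End Complete.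
End DirectPower.


Section OperatorIdeals.
Context (R : realType).

Record op_ideal := OpIdeal {
  op_ideal_family :> forall X Y : banach R, set (bop X Y);
  op_ideal_subspace : forall X Y : banach R,
    linear_subspace (@op_ideal_family X Y);
  op_ideal_comp : forall (W X Y Z : banach R)
    (Q : bop W X) (S : bop X Y) (T : bop Y Z),
    @op_ideal_family X Y S ->
    @op_ideal_family W Z (bop_comp (bop_comp T S) Q)
}.

Definition closed_op_ideal (I : op_ideal) :=
  forall X Y : banach R, closed (I X Y).

Definition nonzero_op_ideal (I : op_ideal) :=
  forall X Y : banach R, I X Y <> [set 0].

Definition bounded_below_on {X Y : normedModType R[i]} (S : bop X Y)
    (W : set X) :=
  exists2 c : R[i], 0 < c & forall x, W x -> c * `|x| <= `|S x|.

Definition strictly_singular (X Y : banach R) : set (bop X Y) := fun S =>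
  forall W : set X, linear_subspace W -> bounded_below_on S W -> finite_dim W.

Definition contained_in (I : op_ideal) 
    (J : forall X Y : banach R, set (bop X Y)) :=
  forall X Y : banach R, I X Y `<=` J X Y.

End OperatorIdeals.
Arguments strictly_singular {R} X Y.

Section QuotientAlgebra.
Context {K : fieldType} {A : algType K}.

(* Properness is what makes the quotient a non-zero ring, as algType demands. *)
Record alg_ideal := AlgIdeal {
  alg_ideal_set :> A -> Prop;
  alg_ideal_subspace : linear_subspace alg_ideal_set;
  alg_ideal_mull : forall a x, alg_ideal_set x -> alg_ideal_set (a * x);
  alg_ideal_mulr : forall a x, alg_ideal_set x -> alg_ideal_set (x * a);
  alg_ideal_proper : ~ alg_ideal_set 1
}.

Variable J : alg_ideal.

Definition in_alg_ideal : {pred A} := [pred x | `[< J x >]].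

Lemma alg_idealZ (k : K) x : x \in in_alg_ideal -> k *: x \in in_alg_ideal.
Proof.
move=> /asboolP Jx; apply/asboolP; rewrite -[_ *: _]addr0.
by apply: (alg_ideal_subspace J).2 => //; exact: (alg_ideal_subspace J).1.
Qed.

Lemma in_alg_ideal_zmod : zmod_closed in_alg_ideal.
Proof.
have [J0 JD] := alg_ideal_subspace J.
split=> [|x y /asboolP Jx /asboolP Jy]; first exact/asboolP.
by apply/asboolP; rewrite addrC -scaleN1r; exact: JD.
Qed.

HB.instance Definition _ := GRing.isZmodClosed.Build A in_alg_ideal
  in_alg_ideal_zmod.

Definition quot_alg := {ideal_quot in_alg_ideal}.
HB.instance Definition _ := GRing.Zmodule.on quot_alg.

Definition quot_pi (x : A) : quot_alg := \pi_({ideal_quot in_alg_ideal}) x.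

Lemma quot_piP x y : quot_pi x = quot_pi y <-> J (x - y).
Proof.
have := Quotient.idealrBE in_alg_ideal x y; rewrite /quot_pi => E.
by split=> [/eqP|/asboolP xy]; [rewrite -E => /asboolP|apply/eqP; rewrite -E].
Qed.

Lemma quot_pi_surj (q : quot_alg) : exists x, quot_pi x = q.
Proof. by exists (repr q); rewrite /quot_pi reprK. Qed.

Lemma quot_pi_repr (q : quot_alg) : quot_pi (repr q) = q.
Proof. exact: reprK. Qed.

Lemma quot_piB : {morph quot_pi : x y / x - y}.
Proof. by move=> x y; rewrite /quot_pi !piE. Qed.

HB.instance Definition _ := GRing.isZmodMorphism.Build A quot_alg quot_pi
  quot_piB.

Definition quot_one : quot_alg := quot_pi 1.
Definition quot_mul (p q : quot_alg) : quot_alg := quot_pi (repr p * repr q).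
Definition quot_scale (k : K) (q : quot_alg) : quot_alg :=
  quot_pi (k *: repr q).

Lemma quot_piM x y : quot_pi (x * y) = quot_mul (quot_pi x) (quot_pi y).
Proof.
apply/quot_piP; set x' := repr _; set y' := repr _.
have Jx : J (x - x') by apply/quot_piP; rewrite quot_pi_repr.
have Jy : J (y - y') by apply/quot_piP; rewrite quot_pi_repr.
have -> : x * y - x' * y' = 1 *: (x * (y - y')) + (x - x') * y'.
  by rewrite scale1r mulrBr mulrBl addrA subrK.
apply: (alg_ideal_subspace J).2; first exact: alg_ideal_mull.
exact: alg_ideal_mulr.
Qed.

Lemma quot_piZ k x : quot_pi (k *: x) = quot_scale k (quot_pi x).
Proof.
apply/quot_piP; set x' := repr _.
have Jx : J (x - x') by apply/quot_piP; rewrite quot_pi_repr.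
by rewrite -scalerBr; apply/asboolP/alg_idealZ/asboolP.
Qed.

Lemma quot_mulA : associative quot_mul.
Proof.
move=> p q r; have [x <-] := quot_pi_surj p.
have [y <-] := quot_pi_surj q; have [z <-] := quot_pi_surj r.
by rewrite -!quot_piM mulrA.
Qed.

Lemma quot_mul1l : left_id quot_one quot_mul.
Proof. by move=> p; have [x <-] := quot_pi_surj p; rewrite -quot_piM mul1r. Qed.

Lemma quot_mul1r : right_id quot_one quot_mul.
Proof. by move=> p; have [x <-] := quot_pi_surj p; rewrite -quot_piM mulr1. Qed.

Lemma quot_mulDl : left_distributive quot_mul +%R.
Proof.
move=> p q r; have [x <-] := quot_pi_surj p.
have [y <-] := quot_pi_surj q; have [z <-] := quot_pi_surj r.
by rewrite -raddfD -!quot_piM mulrDl raddfD.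
Qed.

Lemma quot_mulDr : right_distributive quot_mul +%R.
Proof.
move=> p q r; have [x <-] := quot_pi_surj p.
have [y <-] := quot_pi_surj q; have [z <-] := quot_pi_surj r.
by rewrite -raddfD -!quot_piM mulrDr raddfD.
Qed.

Lemma quot_one_neq0 : quot_one != 0.
Proof.
apply/eqP; rewrite -(raddf0 quot_pi) => /quot_piP; rewrite subr0.
exact: alg_ideal_proper.
Qed.

HB.instance Definition _ := GRing.Zmodule_isNzRing.Build quot_alg
  quot_mulA quot_mul1l quot_mul1r quot_mulDl quot_mulDr quot_one_neq0.

Lemma quot_scaleA a b q : quot_scale a (quot_scale b q) = quot_scale (a * b) q.
Proof. by have [x <-] := quot_pi_surj q; rewrite -!quot_piZ scalerA. Qed.

Lemma quot_scale1 : left_id 1 quot_scale.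
Proof. by move=> q; have [x <-] := quot_pi_surj q; rewrite -quot_piZ scale1r. Qed.

Lemma quot_scaleDr : right_distributive quot_scale +%R.
Proof.
move=> a p q; have [x <-] := quot_pi_surj p; have [y <-] := quot_pi_surj q.
by rewrite -raddfD -!quot_piZ scalerDr raddfD.
Qed.

Lemma quot_scaleDl q : {morph quot_scale^~ q : a b / a + b}.
Proof.
by move=> a b; have [x <-] := quot_pi_surj q; rewrite -!quot_piZ scalerDl raddfD.
Qed.

HB.instance Definition _ := GRing.Zmodule_isLmodule.Build K quot_alg
  quot_scaleA quot_scale1 quot_scaleDr quot_scaleDl.

Lemma quot_scaleAl (k : K) (p q : quot_alg) : k *: (p * q) = k *: p * q.
Proof.
have [x <-] := quot_pi_surj p; have [y <-] := quot_pi_surj q.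
by rewrite -[_ * _]quot_piM -[LHS]quot_piZ scalerAl quot_piM quot_piZ.
Qed.

Lemma quot_scaleAr (k : K) (p q : quot_alg) : k *: (p * q) = p * (k *: q).
Proof.
have [x <-] := quot_pi_surj p; have [y <-] := quot_pi_surj q.
by rewrite -[_ * _]quot_piM -[LHS]quot_piZ scalerAr quot_piM quot_piZ.
Qed.

HB.instance Definition _ := GRing.Lmodule_isLalgebra.Build K quot_alg
  quot_scaleAl.
HB.instance Definition _ := GRing.Lalgebra_isAlgebra.Build K quot_alg
  quot_scaleAr.

Lemma quot_pi_scalable : scalable quot_pi.
Proof. by move=> k x; rewrite quot_piZ. Qed.

Lemma quot_pi_monoid : monoid_morphism quot_pi.
Proof. by split=> // x y; rewrite quot_piM. Qed.

HB.instance Definition _ := GRing.isScalable.Build K A quot_alg *:%R quot_pi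
  quot_pi_scalable.
HB.instance Definition _ := GRing.isMonoidMorphism.Build A quot_alg quot_pi
  quot_pi_monoid.

End QuotientAlgebra.
Arguments alg_ideal {K} A.

Section IdealAt.
Context {R : realType} (I : op_ideal R).
Hypothesis I_ss : contained_in I strictly_singular.
Variable X : banach R.

Lemma op_ideal_mull (T S : bop X X) : I X X S -> I X X (T * S).
Proof.
by move=> /(op_ideal_comp (bop_id X) T); congr (I X X _); exact: bopP.
Qed.

Lemma op_ideal_mulr (T S : bop X X) : I X X S -> I X X (S * T).
Proof.
by move=> /(op_ideal_comp T (bop_id X)); congr (I X X _); exact: bopP.
Qed.

Lemma op_ideal_proper : ~ I X X 1.
Proof.
move=> /I_ss /(_ [set: X]) H; apply: (@banach_infinite_dim R X); apply: H.
  by split.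
by exists 1 => // x _; rewrite mul1r.
Qed.

Definition op_ideal_at : alg_ideal (bop X X) := AlgIdeal
  (op_ideal_subspace I X X) op_ideal_mull op_ideal_mulr op_ideal_proper.

End IdealAt.

(* Splitting of a short exact sequence 0 -> A -> B -> C -> 0, which depends on
   psi : B -> C only; theta need not preserve the units. *)
Definition splits_algebraically {K : fieldType} {B C : algType K} (psi : B -> C) :=
  exists theta : {linear C -> B},
    {morph theta : x y / x * y} /\ cancel theta psi.


(* The group of formal differences p.1 - p.2. The monoid of classes of
   idempotents to which it is applied has a neutral element (the class of 0), so
   this is the Grothendieck group of the underlying semigroup. *)
Section GrothendieckGroup.
Context {V : nmodType}.
Implicit Types p q r : V * V.

Definition groth_rel p q : bool :=
  `[< exists k, p.1 + q.2 + k = q.1 + p.2 + k >].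

Lemma groth_rel_equiv : equiv_class_of groth_rel.
Proof.
split=> [p|p q|q p r]; first by apply/asboolP; exists 0.
  by apply: asbool_equiv_eq; split=> -[k kE]; exists k.
move=> /asboolP[k kE] /asboolP[l lE].
apply/asboolP; exists (q.2 + q.1 + k + l).
rewrite [LHS](AC (2*4) ((1*3*5)*(4*2*6))) /= kE lE.
by rewrite [RHS](AC (2*4) ((4*2*5)*(1*3*6))).
Qed.

Canonical groth_equiv := EquivRelPack groth_rel_equiv.

Definition groth := {eq_quot groth_rel}.
HB.instance Definition _ := Choice.on groth.

Definition groth_pi p : groth := \pi_({eq_quot groth_rel}) p.

Lemma groth_piP p q :
  groth_pi p = groth_pi q <-> exists k, p.1 + q.2 + k = q.1 + p.2 + k.
Proof. by split=> [/eqquotP/asboolP|pq]//; apply/eqquotP/asboolP. Qed.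

Lemma groth_pi_repr (x : groth) : groth_pi (repr x) = x.
Proof. exact: reprK. Qed.

Definition groth_add (x y : groth) : groth := groth_pi (repr x + repr y).
Definition groth_opp (x : groth) : groth :=
  groth_pi ((repr x).2, (repr x).1).

Lemma groth_piD p q : groth_add (groth_pi p) (groth_pi q) = groth_pi (p + q).
Proof.
have /groth_piP[k kE] := groth_pi_repr (groth_pi p).
have /groth_piP[l lE] := groth_pi_repr (groth_pi q).
apply/groth_piP; exists (k + l) => /=.
rewrite [LHS](AC (2*2*2) ((1*3*5)*(2*4*6))) /= kE lE.
by rewrite [RHS](AC (2*2*2) ((1*3*5)*(2*4*6))).
Qed.

Lemma groth_piN p : groth_opp (groth_pi p) = groth_pi (p.2, p.1).
Proof.
have /groth_piP[k kE] := groth_pi_repr (groth_pi p).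
apply/groth_piP; exists k => /=.
rewrite [LHS](AC 3 (2*1*3)) [RHS](AC 3 (2*1*3)) /=.
by rewrite kE.
Qed.

Lemma groth_addA : associative groth_add.
Proof.
move=> x y z; rewrite -(groth_pi_repr x) -(groth_pi_repr y) -(groth_pi_repr z).
by rewrite !groth_piD addrA.
Qed.

Lemma groth_addC : commutative groth_add.
Proof. by move=> x y; rewrite /groth_add addrC. Qed.

Lemma groth_add0 : left_id (groth_pi 0) groth_add.
Proof. by move=> x; rewrite -(groth_pi_repr x) groth_piD add0r. Qed.

Lemma groth_addN : left_inverse (groth_pi 0) groth_opp groth_add.
Proof.
move=> x; rewrite -(groth_pi_repr x) groth_piN groth_piD.
by apply/groth_piP; exists 0; rewrite /= !addr0 add0r; exact: addrC.
Qed.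

HB.instance Definition _ := GRing.isZmodule.Build groth
  groth_addA groth_addC groth_add0 groth_addN.

End GrothendieckGroup.
Arguments groth V : clear implicits.

Section K0.
Context {A : pzRingType}.

Record idem := Idem {
  idem_size : nat;
  idem_mx :> 'M[A]_idem_size;
  idem_size_gt0 : (0 < idem_size)%N;
  idem_mxP : idem_mx *m idem_mx = idem_mx
}.

HB.instance Definition _ := gen_eqMixin idem.
HB.instance Definition _ := gen_choiceMixin idem.

Implicit Types P Q : idem.

Definition idem_rel P Q : bool := `[<
  exists (R : 'M[A]_(idem_size P, idem_size Q))
         (T : 'M[A]_(idem_size Q, idem_size P)),
    idem_mx P = R *m T /\ idem_mx Q = T *m R >].

Lemma idem_rel_equiv : equiv_class_of idem_rel.
Proof.
split=> [P|P Q|Q P S].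
- by apply/asboolP; exists P, P; rewrite idem_mxP.
- by apply: asbool_equiv_eq; split=> -[R [T [RT TR]]]; exists T, R.
- move=> /asboolP[R [T [PE QE]]] /asboolP[U [W [QE' SE]]].
  apply/asboolP; exists (R *m U), (W *m T); split.
    by rewrite -(idem_mxP P) PE !mulmxA -!(mulmxA R) -QE QE' !mulmxA.
  by rewrite -(idem_mxP S) SE !mulmxA -!(mulmxA W) -QE' QE !mulmxA.
Qed.

Canonical idem_equiv := EquivRelPack idem_rel_equiv.

Definition idem_class := {eq_quot idem_rel}.
HB.instance Definition _ := Choice.on idem_class.

Definition idem_pi P : idem_class := \pi_({eq_quot idem_rel}) P.

Lemma idem_piP P Q : idem_pi P = idem_pi Q <->
  exists (R : 'M[A]_(idem_size P, idem_size Q))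
         (T : 'M[A]_(idem_size Q, idem_size P)),
    idem_mx P = R *m T /\ idem_mx Q = T *m R.
Proof. by split=> [/eqquotP/asboolP|PQ]//; apply/eqquotP/asboolP. Qed.

Lemma idem_pi_repr (x : idem_class) : idem_pi (repr x) = x.
Proof. exact: reprK. Qed.

Lemma idem_diag_gt0 P Q : (0 < idem_size P + idem_size Q)%N.
Proof. by rewrite addn_gt0 idem_size_gt0. Qed.

Lemma idem_diagP P Q :
  block_mx (idem_mx P) 0 0 (idem_mx Q) *m block_mx (idem_mx P) 0 0 (idem_mx Q)
  = block_mx (idem_mx P) 0 0 (idem_mx Q).
Proof.
by rewrite mulmx_block !mulmx0 !mul0mx !addr0 !add0r !idem_mxP.
Qed.

Definition idem_diag P Q := Idem (idem_diag_gt0 P Q) (idem_diagP P Q).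

Definition idem0 : idem := @Idem 1 0 isT (mul0mx _ _).

Definition idem_add (x y : idem_class) : idem_class :=
  idem_pi (idem_diag (repr x) (repr y)).

Lemma idem_piD P Q :
  idem_add (idem_pi P) (idem_pi Q) = idem_pi (idem_diag P Q).
Proof.
have /idem_piP[R [T [PE PE']]] := idem_pi_repr (idem_pi P).
have /idem_piP[U [W [QE QE']]] := idem_pi_repr (idem_pi Q).
apply/idem_piP; exists (block_mx R 0 0 U), (block_mx T 0 0 W) => /=.
by rewrite !mulmx_block !mulmx0 !mul0mx !addr0 !add0r PE PE' QE QE'.
Qed.

Lemma idem_addC : commutative idem_add.
Proof.
move=> x y; rewrite -(idem_pi_repr x) -(idem_pi_repr y) !idem_piD.
set P := repr x; set Q := repr y; apply/idem_piP => /=.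
exists (block_mx 0 (idem_mx P) (idem_mx Q) 0).
exists (block_mx 0 (idem_mx Q) (idem_mx P) 0).
by rewrite !mulmx_block !mulmx0 !mul0mx !addr0 !add0r !idem_mxP.
Qed.

Lemma idem_pi_cast P Q (e : idem_size Q = idem_size P) :
  idem_mx P = castmx (e, e) (idem_mx Q) -> idem_pi P = idem_pi Q.
Proof.
case: P Q e => [p P p0 PP] [q Q q0 QQ] /= e; case: p / e P p0 PP => P p0 PP.
by rewrite castmx_id => PQ; apply/idem_piP; exists Q, Q; rewrite QQ /= PQ.
Qed.

Lemma idem_addA : associative idem_add.
Proof.
move=> x y z; rewrite -(idem_pi_repr x) -(idem_pi_repr y) -(idem_pi_repr z).
rewrite !idem_piD; set P := repr x; set Q := repr y; set S := repr z.
apply: (idem_pi_cast (P := idem_diag P (idem_diag Q S))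
  (Q := idem_diag (idem_diag P Q) S) (e := esym (addnA _ _ _))) => /=.
have := @block_mxA _ _ _ _ _ _ _ (idem_mx P) 0 0 0 (idem_mx Q) 0 0 0 (idem_mx S).
by rewrite /= !row_mx0 !col_mx0.
Qed.

Lemma idem_add0 : left_id (idem_pi idem0) idem_add.
Proof.
move=> x; rewrite -(idem_pi_repr x) idem_piD; set P := repr x.
apply/idem_piP; exists (col_mx 0 (idem_mx P)), (row_mx 0 (idem_mx P)) => /=.
rewrite mul_col_row mul_row_col !mulmx0 !mul0mx idem_mxP add0r.
by [].
Qed.

HB.instance Definition _ := GRing.isNmodule.Build idem_class
  idem_addA idem_addC idem_add0.

End K0.
Arguments idem A : clear implicits.
Arguments idem_class A : clear implicits.

Definition K0 (A : pzRingType) : zmodType := groth (idem_class A).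

Definition has_subgroup_isomorphic_to_Z (G : zmodType) :=
  exists H : set G,
    [/\ H 0, forall x y, H x -> H y -> H (x - y) &
        exists f : {additive int -> G}, set_bij [set: int] H f].

Section Fredholm.
Context {R : realType} {X Y : normedModType R[i]}.

Definition bop_ker (T : bop X Y) : set X := [set x | T x = 0].

(* T is Fredholm with index k; closedness of the range is automatic. *)
Definition fredholm_of_index (T : bop X Y) (k : int) :=
  exists a b : nat,
    [/\ has_dim (bop_ker T) a, has_codim (range T) b & k = a%:Z - b%:Z].

Definition linearly_homeomorphic_onto (W : set Y) :=
  exists (T : bop X Y) (S : Y -> X),
    [/\ range T = W, cancel T S & {within W, continuous S}].

End Fredholm.
Arguments linearly_homeomorphic_onto {R} X {Y} W.

(* Main.v *)
(* Let theta be an algebra homomorphism lifting the quotient map pi. If T is a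
   matrix over B(X) which is invertible modulo I(X), then T differs by a matrix
   over I(X), hence by a strictly singular operator on X^N, from the invertible
   matrix theta (pi T) + 1 - theta (pi 1). Up to an invertible factor T is thus
   1 + K with K strictly singular. Such an operator is an invertible one plus a
   finite-rank one, because this property is locally constant along 1 + t K:
   strict singularity makes every 1 + t K bounded below on a subspace of finite
   codimension. Hence a left inverse of T is also a right inverse.

   If a multiple of the class of a rank-one idempotent vanishes in K_0, then some
   operator on an X^N is left but not right invertible, with a finite-rank
   defect. An isomorphism of X^m onto a proper subspace of finite codimension is
   another such operator. Finite-rank operators belong to I. *)
From HB Require Import structures.
Require Import Defs.
From mathcomp Require Import all_boot all_order all_algebra.
From mathcomp Require Import complex ring lra.
From mathcomp Require Import all_classical all_reals all_analysis.

Set Implicit Arguments.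
Unset Strict Implicit.
Unset Printing Implicit Defensive.

Import Order.TTheory GRing.Theory Num.Theory.
Import numFieldNormedType.Exports.

Local Open Scope classical_set_scope.
Local Open Scope ring_scope.

(** * Real-valued norms *)

(** Since [theta] need not be continuous, only algebraic identities can be pushed through it; for
    this reason operators on X^N are handled as matrices over B(X), to whose entries [theta]
    applies. All the analysis is thereby confined to 1 + K with K strictly singular. Such a K need
    not be compact, so approximating it by finite-rank operators is not an option. What strict
    singularity does give is, for each t, a finite list of functionals on whose common kernel 1 + t
    K is bounded below. A finite-rank G turns this into 1 + t K + G being bounded below or right
    invertible on the whole space, and each of these survives a small change of t. Index zero then
    passes from one neighbour of t to any other through the same G, with nothing known at t itself.
    Additivity and stability of the Fredholm index are avoided: index zero means invertible plus
    finite-rank, and for such operators injectivity and surjectivity are equivalent by linear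
    algebra. *)

Section RealNorm.
Context {R : realType}.
Local Open Scope complex_scope.
Implicit Types Z : normedModType R[i].

Definition cabs (a : R[i]) : R := @rnorm R R[i]^o a.

Lemma cabsE (a : R[i]) : (cabs a)%:C = `|a|.
Proof. exact: (@rnormE R R[i]^o a). Qed.

Lemma cabs_real (t : R) : cabs t%:C = `|t|.
Proof.
by apply: complexI; rewrite cabsE normc_def /= expr0n /= addr0 sqrtr_sqr.
Qed.

Lemma rnorm_le Z (x : Z) (t : R) : (rnorm x <= t) = (`|x| <= t%:C).
Proof. by rewrite -rnormE lecR. Qed.

Lemma rnormD Z (x y : Z) : rnorm (x + y) <= rnorm x + rnorm y.
Proof. by rewrite -lecR rmorphD /= !rnormE ler_normD. Qed.

Lemma rnormN Z (x : Z) : rnorm (- x) = rnorm x.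
Proof. by rewrite /rnorm normrN. Qed.

Lemma rnormBC Z (x y : Z) : rnorm (x - y) = rnorm (y - x).
Proof. by rewrite -rnormN opprB. Qed.

Lemma rnorm_tri Z (y x z : Z) : rnorm (x - z) <= rnorm (x - y) + rnorm (y - z).
Proof. by apply: le_trans (rnormD _ _); rewrite addrA subrK. Qed.

Lemma rnormZ Z (a : R[i]) (x : Z) : rnorm (a *: x) = cabs a * rnorm x.
Proof. by apply: complexI; rewrite rmorphM /= cabsE !rnormE normrZ. Qed.

Lemma rnormZr Z (t : R) (x : Z) : rnorm (t%:C *: x) = `|t| * rnorm x.
Proof. by rewrite rnormZ cabs_real. Qed.

Lemma rnorm0 Z : rnorm (0 : Z) = 0.
Proof. by rewrite /rnorm normr0. Qed.

Lemma rnorm_eq0 Z (x : Z) : rnorm x = 0 -> x = 0.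
Proof. by move=> x0; apply/eqP; rewrite -normr_eq0 -rnormE x0. Qed.

Lemma rnorm_gt0 Z (x : Z) : x <> 0 -> 0 < rnorm x.
Proof. by move=> x0; rewrite lt_def rnorm_ge0 andbT;
  apply/eqP => /rnorm_eq0. Qed.

Lemma cabs_ge0 a : 0 <= cabs a. Proof. exact: rnorm_ge0. Qed.

Lemma cabsN a : cabs (- a) = cabs a. Proof. exact: rnormN. Qed.

Lemma cabsM a b : cabs (a * b) = cabs a * cabs b. Proof. exact: rnormZ. Qed.

Lemma cabs1 : cabs 1 = 1.
Proof. by have := cabs_real 1; rewrite normr1 rmorph1. Qed.

Lemma cabs_eq0 a : cabs a = 0 -> a = 0. Proof. exact: rnorm_eq0. Qed.

Lemma rnorm_sum Z I (r : seq I) (F : I -> Z) :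
  rnorm (\sum_(i <- r) F i) <= \sum_(i <- r) rnorm (F i).
Proof.
elim/big_rec2: _ => [|i u v _ IH]; first by rewrite rnorm0.
by apply: le_trans (rnormD _ _) _; rewrite lerD2l.
Qed.

Lemma le0_geometric (x C : R) : (forall n, x <= C * 2^-1 ^+ n) -> x <= 0.
Proof.
move=> xC; rewrite leNgt; apply/negP => x0.
set n := Num.truncn (C / x).
have : C / x < n.+1%:R by exact: truncnS_gt.
rewrite ltr_pdivrMr// => Cn; have := xC n; rewrite leNgt => /negP; apply.
rewrite exprVn ltr_pdivrMr ?exprn_gt0//; apply: lt_le_trans Cn _.
rewrite mulrC; apply: ler_wpM2l; first exact: ltW.
by rewrite -natrX ler_nat ltn_expl.
Qed.

Lemma eq0_geometric Z (x : Z) (C : R) :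
  (forall n, rnorm x <= C * 2^-1 ^+ n) -> x = 0.
Proof.
move=> /le0_geometric x0; apply: rnorm_eq0; apply/eqP.
by rewrite eq_le x0 rnorm_ge0.
Qed.

End RealNorm.

(** * Completeness along geometric sequences *)

Section GeometricSequences.
Context {R : realType}.
Local Open Scope complex_scope.

(** Completeness with a rate, so that identities for limits follow from [eq0_geometric]. The
    constant [k] is chosen before the sequence: [open_mapping] needs this for a bound uniform in the
    target vector. The property also passes to products and finite powers. *)
Definition geo_complete (V : normedModType R[i]) := exists k : R, forall u C,
  (forall n, rnorm (u n.+1 - u n : V) <= C * 2^-1 ^+ n) ->
  exists l, forall n, rnorm (l - u n) <= k * C * 2^-1 ^+ n.

Lemma half_exp_gt0 n : 0 < 2^-1 ^+ n :> R.
Proof. by rewrite exprn_gt0// invr_gt0. Qed.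

Lemma geo_dist (V : normedModType R[i]) (u : nat -> V) (C : R) :
  (forall n, rnorm (u n.+1 - u n) <= C * 2^-1 ^+ n) ->
  forall n k, rnorm (u (n + k)%N - u n) <= 2 * C * 2^-1 ^+ n.
Proof.
move=> uC.
have C0 : 0 <= C by have := uC 0; rewrite expr0 mulr1; apply: le_trans;
  exact: rnorm_ge0.
(* The exact partial sum of the geometric series makes the induction on [k] go through; the bare
   bound would not. *)
suff H n k : rnorm (u (n + k)%N - u n) <= 2 * C * (2^-1 ^+ n - 2^-1 ^+ (n + k)).
  move=> n k; apply: le_trans (H n k) _.
  by rewrite ler_wpM2l ?mulr_ge0// gerBl ltW// half_exp_gt0.
elim: k => [|k IH]; first by rewrite addn0 subrr rnorm0 subrr mulr0.
rewrite addnS; apply: le_trans (rnorm_tri (u (n + k)%N) _ _) _.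
apply: le_trans (lerD (uC _) IH) _; rewrite exprS.
set a := _ ^+ (n + k); set b := _ ^+ n.
by have -> : 2 * C * (b - 2^-1 * a) = C * a + 2 * C * (b - a) by field.
Qed.

Lemma geo_small (C e : R) : 0 < e -> exists n, C * 2^-1 ^+ n < e.
Proof.
move=> e0; apply: contrapT => /forallNP H.
have : e <= 0 by apply: (@le0_geometric _ _ C) => n; rewrite leNgt;
  apply/negP/H.
by rewrite leNgt e0.
Qed.

Lemma geo_complete_banach (V : completeNormedModType R[i]) : geo_complete V.
Proof.
exists 2 => u C uC; have ud := geo_dist uC.
have : cauchy (u @ \oo).
  apply: cauchy_exP => e e0.
  have ee : (complex.Re e)%:C = e by rewrite RRe_real// ger0_real// ltW.
  have e0' : 0 < complex.Re e by rewrite -ltcR ee.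
  have [n nC] := geo_small (2 * C) e0'.
  exists (u n); exists n => // m /= nm.
  rewrite -ball_normE /= -rnormE -ee ltcR; apply: le_lt_trans nC.
  by rewrite rnormBC -(subnKC nm).
move=> /cauchy_cvg /cvg_ex[l ul]; exists l => n.
apply/ler_addgt0Pr => e e0.
have /cvgrPdist_le/(_ e%:C) := ul; rewrite ltcR => /(_ e0)[N _ NP].
apply: le_trans (rnorm_tri (u (n + N)%N) _ _) _; rewrite addrC lerD//.
by rewrite rnorm_le; apply: NP => /=; rewrite leq_addl.
Qed.

(** The intervals of centre [u n] and radius C 2^-n meet pairwise, so the supremum of their left
    endpoints lies in all of them. *)
Lemma geo_real_limit (u : nat -> R) (C : R) :
  (forall n k, `|u (n + k)%N - u n| <= C * 2^-1 ^+ n) ->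
  exists l, forall n, `|l - u n| <= C * 2^-1 ^+ n.
Proof.
move=> uC; pose A := [set x | exists n, x = u n - C * 2^-1 ^+ n].
have C0 : 0 <= C by have := uC 0 0%N; rewrite expr0 mulr1; exact: le_trans.
have CC m n : (m <= n)%N -> C * 2^-1 ^+ n <= C * 2^-1 ^+ m.
  by move=> mn; rewrite ler_wpM2l// ler_wiXn2l ?invr_ge0// invf_le1// ler1n.
have ub n : ubound A (u n + C * 2^-1 ^+ n).
  move=> _ [m ->]; have [mn|/ltnW nm] := leqP m n.
    have := uC m (n - m)%N; rewrite subnKC// ler_norml => /andP[? _].
    by have := half_exp_gt0 n; have := mulr_ge0 C0 (ltW (half_exp_gt0 n)); lra.
  have := uC n (m - n)%N; rewrite subnKC// ler_norml => /andP[_ ?].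
  by have := mulr_ge0 C0 (ltW (half_exp_gt0 m)); lra.
have A0 : A !=set0 by exists (u 0%N - C * 2^-1 ^+ 0), 0%N.
exists (sup A) => n; rewrite ler_norml; apply/andP; split.
  have : u n - C * 2^-1 ^+ n <= sup A.
    by apply: ub_le_sup; [exists (u 0%N + C * 2^-1 ^+ 0); exact: ub | exists n].
  lra.
have : sup A <= u n + C * 2^-1 ^+ n by apply: ge_sup A0 (ub n).
lra.
Qed.

Lemma cabs_Re (z : R[i]) : `|complex.Re z| <= cabs z.
Proof.
case: z => a b; rewrite /cabs /rnorm /= -sqrtr_sqr ler_wsqrtr//.
by rewrite lerDl sqr_ge0.
Qed.

Lemma cabs_Im (z : R[i]) : `|complex.Im z| <= cabs z.
Proof.
case: z => a b; rewrite /cabs /rnorm /= -sqrtr_sqr ler_wsqrtr//.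
by rewrite lerDr sqr_ge0.
Qed.

Lemma cabs_le (z : R[i]) : cabs z <= `|complex.Re z| + `|complex.Im z|.
Proof.
case: z => a b; rewrite /cabs /rnorm /=.
rewrite -[leRHS]ger0_norm ?addr_ge0// -sqrtr_sqr ler_wsqrtr//.
rewrite sqrrD !real_normK ?num_real// -addrA lerD2l lerDr.
by rewrite mulrn_wge0// mulr_ge0.
Qed.

Lemma geo_complete_scalars : geo_complete R[i]^o.
Proof.
(* A factor 2 from [geo_dist] for each of the real and imaginary parts. *)
exists 4 => u C uC; have ud := geo_dist uC.
have [n k|a aP] := @geo_real_limit (fun n => complex.Re (u n)) (2 * C).
  by rewrite -raddfB; apply: le_trans (cabs_Re _) (ud n k).
have [n k|b bP] := @geo_real_limit (fun n => complex.Im (u n)) (2 * C).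
  by rewrite -raddfB; apply: le_trans (cabs_Im _) (ud n k).
exists (a +i* b) => n; apply: le_trans (cabs_le _) _.
have := lerD (aP n) (bP n); rewrite !raddfB /=.
by move=> h; apply: le_trans h _; rewrite -!mulrDl -natrD.
Qed.

Lemma rnorm_power (X : normedModType R[i]) N (x : power X N) :
  rnorm x = \sum_i rnorm (x i).
Proof.
apply: complexI; rewrite rnormE power_normE raddf_sum /=.
by apply: eq_bigr => i _; rewrite rnormE.
Qed.

Lemma geo_complete_power (V : normedModType R[i]) m :
  geo_complete V -> geo_complete (power V m).
Proof.
move=> [k kV]; exists (m%:R * k) => u C uC.
have le_rn (x : power V m) i : rnorm (x i) <= rnorm x.
  by rewrite -lecR !rnormE le_power_norm.
have /choice[l lP] : forall i, exists l, forall n,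
    rnorm (l - u n i) <= k * C * 2^-1 ^+ n.
  move=> i; apply: (kV (fun n => u n i)) => n; apply: le_trans (uC n).
  by have := le_rn (u n.+1 - u n) i; rewrite !ffunE.
exists [ffun i => l i] => n; rewrite rnorm_power.
apply: (@le_trans _ _ (\sum_(i < m) (k * C * 2^-1 ^+ n))).
  by apply: ler_sum => i _; rewrite !ffunE.
by rewrite sumr_const card_ord -[leLHS]mulr_natl !mulrA.
Qed.

Lemma rnorm_pairE (V W : normedModType R[i]) (x : V) (y : W) :
  rnorm ((x, y) : V * W) = Num.max (rnorm x) (rnorm y).
Proof.
apply: complexI; rewrite rnormE prod_normE /= -!rnormE.
rewrite /Num.max /Order.max !ltcR.
by case: ifP.
Qed.

Lemma geo_complete_prod (V W : normedModType R[i]) :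
  geo_complete V -> geo_complete W -> geo_complete (V * W)%type.
Proof.
move=> [k kV] [k' kW]; exists (`|k| + `|k'|) => u C uC.
have C0 : 0 <= C by have := uC 0; rewrite expr0 mulr1; apply: le_trans;
  exact: rnorm_ge0.
have uE n : u n.+1 - u n = ((u n.+1).1 - (u n).1, (u n.+1).2 - (u n).2) by [].
have [n|a aP] := kV (fun n => (u n).1) C.
  by apply: le_trans (uC n); rewrite uE rnorm_pairE le_max lexx.
have [n|b bP] := kW (fun n => (u n).2) C.
  by apply: le_trans (uC n); rewrite uE rnorm_pairE le_max lexx orbT.
exists (a, b) => n.
have -> : (a, b) - u n = (a - (u n).1, b - (u n).2) by [].
have Cn : 0 <= C * 2^-1 ^+ n by rewrite mulr_ge0// ltW// half_exp_gt0.
rewrite rnorm_pairE ge_max -!mulrA.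
apply/andP; split; [apply: le_trans (aP n) _ | apply: le_trans (bP n) _].
  by rewrite -mulrA ler_wpM2r//; apply: le_trans (ler_norm _) _; rewrite lerDl.
by rewrite -mulrA ler_wpM2r//; apply: le_trans (ler_norm _) _; rewrite lerDr.
Qed.

End GeometricSequences.

(** * The Hahn-Banach theorem *)

Section BoundedMaps.
Context {R : realType}.
Local Open Scope complex_scope.

Lemma bop_bounded {X Y : normedModType R[i]} (T : bop X Y) :
  exists2 M : R, 0 < M & forall x, rnorm (T x) <= M * rnorm x.
Proof.
exists (op_norm T + 1) => [|x]; first by rewrite ltr_wpDl// op_norm_ge0.
apply: (@le_trans _ _ (op_norm T * rnorm x)); last first.
  by rewrite ler_wpM2r ?rnorm_ge0// lerDl.
by rewrite rnorm_le rmorphM /= rnormE le_op_norm.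
Qed.

Lemma bop_of {X Y : normedModType R[i]} (f : X -> Y) (M : R) :
  linear f -> (forall x, rnorm (f x) <= M * rnorm x) ->
  exists T : bop X Y, forall x, T x = f x.
Proof.
move=> lf fM.
pose f' : {linear X -> Y} :=
  HB.pack f (GRing.isLinear.Build R[i] X Y _ f lf).
have cf : continuous f.
  apply/(linear_bounded_continuous f')/linear_boundedP.
  near=> r => x; rewrite -!rnormE.
  apply: (@le_trans _ _ (`|M|%:C * (rnorm x)%:C)).
    rewrite -rmorphM lecR; apply: le_trans (fM x) _.
    by rewrite ler_wpM2r ?rnorm_ge0// ler_norm.
  rewrite ler_wpM2r ?le0C ?rnorm_ge0//.
  by near: r; apply: nbhs_pinfty_ge; rewrite ger0_real// le0C.
have H : f \in @is_bop R X Y by apply/asboolP.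
by exists (Bop H).
Unshelve. all: by end_near. Qed.

End BoundedMaps.

Section HahnBanach.
Context {R : realType} {Z : normedModType R[i]}.
Local Open Scope complex_scope.

(* G is the graph of a real-linear functional on a real subspace; domination by
   the norm forces single-valuedness. *)
Definition dominated_graph (G : set (Z * R)) := [/\ G (0, 0),
  forall t x a y b, G (x, a) -> G (y, b) -> G (t%:C *: x + y, t * a + b) &
  forall x a, G (x, a) -> a <= rnorm x].

(** A value s at y is admissible when b - |x - y| <= s <= |x + y| - b over the graph. The triangle
    inequality puts each left side below each right side, so the supremum of the left sides works;
    homogeneity reduces a general multiple of y to these two cases. No distinction is made on
    whether y already lies in the domain. *)
Lemma dominated_graph_extend G y : dominated_graph G ->
  exists2 G', dominated_graph G' & G `<=` G' /\ exists a, G' (y, a).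
Proof.
move=> [G0 GD Gle].
have GB x a x' a' : G (x, a) -> G (x', a') -> G (x + x', a + a').
  by move=> Gx Gx'; have := GD 1 _ _ _ _ Gx Gx'; rewrite scale1r mul1r.
have GZ t x a : G (x, a) -> G (t%:C *: x, t * a).
  by move=> Gx; have := GD t _ _ _ _ Gx G0; rewrite !addr0.
pose A := [set c | exists x b, G (x, b) /\ c = b - rnorm (x - y)].
have ubA x b : G (x, b) -> ubound A (rnorm (x + y) - b).
  move=> Gx _ [x' [b' [Gx' ->]]].
  have := Gle _ _ (GB _ _ _ _ Gx Gx').
  have := rnormD (x + y) (x' - y); rewrite addrACA subrr addr0; lra.
have A0 : A !=set0 by exists (0 - rnorm (0 - y)), 0, 0.
pose s := sup A.
have sle x b : G (x, b) -> b + s <= rnorm (x + y).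
  by move=> Gx; have := ge_sup A0 (ubA _ _ Gx); rewrite -/s; lra.
have les x b : G (x, b) -> b - s <= rnorm (x - y).
  move=> Gx; have : b - rnorm (x - y) <= s; last by lra.
  apply: ub_le_sup; first by exists (rnorm (0 + y) - 0); exact: ubA.
  by exists x, b.
exists [set p | exists t x b,
    [/\ G (x, b), p.1 = x + t%:C *: y & p.2 = b + t * s]].
  split=> [|t x a x' a' [r [z [b [Gz /= -> ->]]]]
      [r' [z' [b' [Gz' /= -> ->]]]]|x a].
  - by exists 0, 0, 0; rewrite /= scale0r mul0r !addr0.
  - exists (t * r + r'), (t%:C *: z + z'), (t * b + b'); split; first exact: GD.
      by rewrite /= rmorphD rmorphM /= scalerDl scalerDr scalerA addrACA.
    by rewrite /=; ring.
  - move=> [t [z [b [Gz /= -> ->]]]].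
    have [t0|t0|->] := ltgtP t 0; last first.
    + by rewrite scale0r mul0r !addr0; exact: Gle.
    + have := sle _ _ (GZ t^-1 _ _ Gz) => h.
      have -> : z + t%:C *: y = t%:C *: ((t^-1)%:C *: z + y).
        by rewrite scalerDr scalerA -rmorphM /= mulfV ?gt_eqF// scale1r.
      have -> : b + t * s = t * (t^-1 * b + s) by field; rewrite gt_eqF.
      by rewrite rnormZr gtr0_norm// ler_pM2l.
    + have t0' : 0 < - t by rewrite oppr_gt0.
      have := les _ _ (GZ (- t)^-1 _ _ Gz) => h.
      have -> : z + t%:C *: y = (- t)%:C *: (((- t)^-1)%:C *: z - y).
        rewrite scalerBr scalerA -rmorphM /= mulfV ?gt_eqF// scale1r.
        by rewrite rmorphN scaleNr opprK.
      have -> : b + t * s = (- t) * ((- t)^-1 * b - s) by field; rewrite lt_eqF.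
      by rewrite rnormZr gtr0_norm// ler_pM2l.
split=> [[x b] Gx|]; last by exists s, 1, 0, 0; rewrite /= scale1r mul1r !add0r.
by exists 0, x, b; rewrite /= scale0r mul0r !addr0.
Qed.

Lemma real_hahn_banach (x0 : Z) : exists u : Z -> R,
  [/\ forall t x y, u (t%:C *: x + y) = t * u x + u y,
      forall x, u x <= rnorm x & u x0 = rnorm x0].
Proof.
have dg0 : dominated_graph
    [set p | exists t : R, p = (t%:C *: x0, t * rnorm x0)].
  split=> [|t x a y b [r [-> ->]] [r' [-> ->]]|x a [t [-> ->]]].
  - by exists 0; rewrite scale0r mul0r.
  - exists (t * r + r').
    by rewrite rmorphD rmorphM /= scalerDl scalerA mulrDl mulrA.
  - by rewrite rnormZr ler_wpM2r ?rnorm_ge0// ler_norm.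
set G0 := [set p | _] in dg0.
(* The property is imposed on the union with [G0], so that it also holds for the empty union of the
   empty chain. *)
have [F FS Ftot|G [dgG Gmax]] :=
    @Zorn_bigcup _ (fun G => dominated_graph (G0 `|` G)).
  have [F0|/set0P[B FB]] := eqVneq F set0.
    by rewrite F0 bigcup_set0 setU0.
  have lub p q : (G0 `|` \bigcup_(X in F) X) p ->
      (G0 `|` \bigcup_(X in F) X) q ->
      exists2 C, F C & (G0 `|` C) p /\ (G0 `|` C) q.
    move=> [Gp|[C FC Cp]] [Gq|[D FD Dq]].
    - by exists B => //; split; left.
    - by exists D => //; split; [left|right].
    - by exists C => //; split; [right|left].
    - have [CD|DC] := Ftot _ _ FC FD.
        by exists D => //; split; right => //; exact: CD.
      by exists C => //; split; right => //; exact: DC.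
  split.
  - by left; case: dg0.
  - move=> t x a y b Gx Gy; have [C FC [Cx Cy]] := lub _ _ Gx Gy.
    have [_ CD _] := FS _ FC; case: (CD t _ _ _ _ Cx Cy); first by left.
    by right; exists C.
  - move=> x a Gx; have [C FC [Cx _]] := lub _ _ Gx Gx.
    by have [_ _] := FS _ FC; exact.
have total y : exists a, (G0 `|` G) (y, a).
  have [G' dgG' [GG' [a G'y]]] := dominated_graph_extend y dgG.
  have U : G0 `|` G' = G'.
    by apply/seteqP; split=> [p [Gp|//]|p ?]; [apply: GG'; left|right].
  exists a; apply: contrapT => nG; apply: (Gmax G'); last by rewrite U.
  split=> [p Gp|G'G]; first by apply: GG'; right.
  by apply: nG; right; exact: G'G.
have [u uP] := choice total.
have [d0 dD dle] := dgG.
have uniq_val x a b : (G0 `|` G) (x, a) -> (G0 `|` G) (x, b) -> a = b.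
  suff H c d : (G0 `|` G) (x, c) -> (G0 `|` G) (x, d) -> d <= c.
    by move=> xa xb; apply/eqP; rewrite eq_le !H.
  move=> xc xd; have := dD (-1) _ _ _ _ xc xd.
  rewrite rmorphN rmorph1 scaleN1r addNr => /dle; rewrite rnorm0; lra.
exists u; split=> [t x y|x|].
- exact: uniq_val (uP _) (dD _ _ _ _ _ (uP _) (uP _)).
- exact: dle (uP _).
- apply: uniq_val (uP _) _; left; exists 1.
  by rewrite scale1r mul1r.
Qed.

Lemma cabs_rotate (z : R[i]) :
  exists2 w : R[i], cabs w = 1 & w * z = (cabs z)%:C.
Proof.
have [->|z0] := eqVneq z 0.
  by exists 1; [exact: cabs1 | rewrite mulr0 /cabs rnorm0].
have cz : cabs z != 0 by apply: contra_neq z0 => /cabs_eq0.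
have czz : (cabs z)%:C / z * z = (cabs z)%:C by rewrite mulfVK.
exists ((cabs z)%:C / z) => //.
apply: (mulIf cz); rewrite mul1r -cabsM czz cabs_real.
by rewrite ger0_norm// cabs_ge0.
Qed.

(** u(x) - i u(i x) is the complex-linear functional with real part u. Rotating x makes its value
    real and non-negative, whence the bound by the norm. At [x0] the real part already exhausts that
    bound, so the imaginary part vanishes. *)
Lemma hahn_banach (x0 : Z) : exists f : bop Z R[i]^o,
  (forall x, cabs (f x) <= rnorm x) /\ f x0 = (rnorm x0)%:C.
Proof.
have [u [uD ule ux0]] := real_hahn_banach x0.
have uA x y : u (x + y) = u x + u y.
  by have := uD 1 x y; rewrite scale1r mul1r.
have u0 : u 0 = 0 by have := uA 0 0; rewrite addr0; lra.
have uZ (t : R) x : u (t%:C *: x) = t * u x.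
  by have := uD t x 0; rewrite !addr0 u0 addr0.
pose f (x : Z) : R[i]^o := (u x)%:C - 'i * (u ('i *: x))%:C.
have fRe x : complex.Re (f x) = u x.
  by rewrite /f /=; rewrite !(mul0r, mul1r, mulr0, subr0, oppr0, addr0, add0r).
have fD x y : f (x + y) = f x + f y.
  rewrite /f scalerDr !uA !rmorphD /=; ring.
have fR (t : R) x : f (t%:C *: x) = t%:C * f x.
  rewrite /f scalerA [_ * t%:C]mulrC -scalerA !uZ !rmorphM /=; ring.
have ii : 'i * 'i = -1 :> R[i] by rewrite -expr2 sqr_i.
have fi x : f ('i *: x) = 'i * f x.
  have uN : u (- x) = - u x by rewrite -scaleN1r; have := uZ (-1) x;
    rewrite rmorphN1 mulN1r.
  by rewrite /f scalerA ii scaleN1r uN mulrBr mulrA ii rmorphN mulN1r opprK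
    mulrN opprK addrC.
have fZ (a : R[i]) x : f (a *: x) = a * f x.
  by rewrite (complexE a) scalerDl -scalerA fD fi !fR mulrDl mulrA.
have fle x : cabs (f x) <= rnorm x.
  have [w w1 wf] := cabs_rotate (f x).
  have := ule (w *: x); rewrite rnormZ w1 mul1r -fRe fZ wf.
  by [].
have [T TP] : exists T : bop Z R[i]^o, forall x, T x = f x.
  apply: (@bop_of _ _ _ _ 1) => [a x y|x]; first by rewrite fD fZ.
  by rewrite mul1r; exact: fle.
exists T; split=> [x|]; rewrite TP; first exact: fle.
have := fle x0; have := fRe x0; rewrite ux0; case: (f x0) => a b /= ->.
rewrite /cabs /rnorm /= -/(rnorm x0) => h.
have h2 : rnorm x0 ^+ 2 + b ^+ 2 <= rnorm x0 ^+ 2.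
  rewrite -[leLHS]sqr_sqrtr ?addr_ge0 ?sqr_ge0//.
  by rewrite lerXn2r// nnegrE ?sqrtr_ge0 ?rnorm_ge0.
suff -> : b = 0 by [].
by apply/eqP; rewrite -sqrf_eq0 eq_le sqr_ge0 andbT; lra.
Qed.

Lemma norming_functional (z : Z) : z <> 0 -> exists f : bop Z R[i]^o, f z = 1.
Proof.
move=> /rnorm_gt0 z0; have [f [_ fz]] := hahn_banach z.
exists ((rnorm z)^-1%:C *: f); rewrite -[LHS]/((rnorm z)^-1%:C * f z) fz.
by rewrite -rmorphM /= mulVf// gt_eqF.
Qed.

End HahnBanach.

(** * The open mapping theorem *)

Section OpenMapping.
Context {R : realType} {V Z : normedModType R[i]}.
Hypotheses (cV : geo_complete V) (cZ : geo_complete Z).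
Variables (U : {linear V -> Z}) (M : R).
Hypotheses (UM : forall v, rnorm (U v) <= M * rnorm v).
Hypothesis U_surj : forall z, exists v, U v = z.
Local Open Scope complex_scope.

(* Baire's argument: otherwise nested balls avoid the closures of the images of
   all balls. *)
Lemma open_mapping_somewhere : exists (N : R) z0 (r : R), 0 < r /\
  forall z, rnorm (z - z0) <= r -> forall e : R, 0 < e ->
    exists2 v, rnorm v <= N & rnorm (z - U v) <= e.
Proof.
apply: contrapT => H.
(* One nested ball: its radius at least halves, and it misses the images of all v of norm at most n.
   Positivity of the radius is a premise inside the existential because [choice] needs a total
   function. *)
have step : forall p : nat * (Z * R), exists q : Z * R, 0 < p.2.2 ->
    [/\ 0 < q.2, rnorm (q.1 - p.2.1) <= p.2.2 / 2, q.2 <= p.2.2 / 2 &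
        forall v, rnorm v <= p.1%:R -> q.2 < rnorm (q.1 - U v)].
  move=> [n [z0 r]]; have [r0|r0] := ltP 0 r; last first.
    by exists (0, 0).
  have [z [zr [e [e0 ev]]]] : exists z, rnorm (z - z0) <= r / 2 /\
      exists e : R, 0 < e /\ forall v, rnorm v <= n%:R -> e < rnorm (z - U v).
    apply: contrapT => H1; apply: H; exists n%:R, z0, (r / 2); split;
      first by lra.
    move=> z zr e e0; apply: contrapT => H2; apply: H1; exists z; split=> //.
    exists e; split=> // v vn; rewrite ltNge; apply/negP => zv.
    by apply: H2; exists v.
  exists (z, Num.min e (r / 2)) => _ /=; split=> //.
  - by rewrite lt_min e0 /=; lra.
  - by rewrite ge_min lexx orbT.
  - by move=> v /ev; apply: le_lt_trans; rewrite ge_min lexx.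
have [f fP] := choice step.
pose p n := iteri n (fun k q => f (k, q)) (0 : Z, 1 : R).
have pS n : p n.+1 = f (n, p n) by [].
have p0 n : 0 < (p n).2.
  by elim: n => [|n IH]; [exact: ltr01 | rewrite pS; case: (fP (n, p n) IH)].
have pr n : (p n.+1).2 <= (p n).2 / 2 by rewrite pS; case: (fP (n, p n) (p0 n)).
have pz n : rnorm ((p n.+1).1 - (p n).1) <= (p n).2 / 2.
  by rewrite pS; case: (fP (n, p n) (p0 n)).
have pU n v : rnorm v <= n%:R -> (p n.+1).2 < rnorm ((p n.+1).1 - U v).
  by rewrite pS; case: (fP (n, p n) (p0 n)) => _ _ _; exact.
have pg n : (p n).2 <= 2^-1 ^+ n.
  elim: n => [|n IH]; first by rewrite expr0.
  by rewrite exprS; apply: le_trans (pr n) _;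
    rewrite mulrC ler_wpM2l// invr_ge0.
have pzn n k : rnorm ((p (n + k)%N).1 - (p n).1) <= (p n).2.
  suff : rnorm ((p (n + k)%N).1 - (p n).1) <= (p n).2 - (p (n + k)%N).2.
    by have := p0 (n + k)%N; lra.
  elim: k => [|k IH]; first by rewrite addn0 !subrr rnorm0.
  rewrite addnS; apply: le_trans (rnorm_tri (p (n + k)%N).1 _ _) _.
  by have := pz (n + k)%N; have := pr (n + k)%N; lra.
have [kap kP] := cZ.
have [n|l lP] := kP (fun n => (p n).1) 1.
  by have := pz n; have := pg n; have := half_exp_gt0 (R := R) n;
    rewrite mul1r; lra.
(* The rate supplied by [geo_complete] carries an extra factor [kap]. Comparing through the centre
   of index n + k for every k removes it, so that the limit lies in each ball itself. *)
have ll n : rnorm (l - (p n).1) <= (p n).2.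
  rewrite -subr_le0; apply: (@le0_geometric _ _ (`|kap|)) => k.
  have := rnorm_tri (p (n + k)%N).1 l (p n).1; have := pzn n k;
    have := lP (n + k)%N.
  have : kap * 1 * 2^-1 ^+ (n + k) <= `|kap| * 2^-1 ^+ k.
    rewrite mulr1 exprD mulrA; apply: ler_wpM2r;
      first by rewrite ltW// half_exp_gt0.
    apply: le_trans (ler_norm _) _; rewrite normrM ler_piMr//.
    by rewrite ger0_norm ?exprn_ge0 ?invr_ge0// exprn_ile1 ?invr_ge0//
      invf_le1// ler1n.
  lra.
have [v vl] := U_surj l.
pose n := (Num.truncn (rnorm v)).+1.
have /(pU n) : rnorm v <= n%:R by rewrite ltW// truncnS_gt.
by rewrite vl rnormBC ltNge ll.
Qed.

(** Approximating both z0 + a z and z0, subtracting and dividing by a moves the ball to the origin: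
    each z is approximated as closely as desired by some U v with |v| <= C0 |z|. Repeating this on
    the residual, halved at each stage, builds a preimage as a geometric limit. *)
Lemma open_mapping : exists2 C : R, 0 < C &
  forall z, exists2 v, U v = z & rnorm v <= C * rnorm z.
Proof.
have [N [z0 [r [r0 H]]]] := open_mapping_somewhere.
have N0 : 0 <= N.
  have [|v vN _] := H z0 _ 1 ltr01; first by rewrite subrr rnorm0 ltW.
  exact: le_trans (rnorm_ge0 v) vN.
pose C0 := 2 * N / r.
have approx z (e : R) : 0 < e ->
    exists2 v, rnorm v <= C0 * rnorm z & rnorm (z - U v) <= e.
  move=> e0; have [->|/eqP/rnorm_gt0 z_gt0] := eqVneq z 0.
    exists 0; first by rewrite !rnorm0 mulr0.
    by rewrite linear0 subrr rnorm0 ltW.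
  pose a := r / rnorm z; have a0 : 0 < a by rewrite divr_gt0.
  (* Two approximation errors of this size, divided by [a], add up to [e]. *)
  have e'0 : 0 < a * e / 2 by apply: divr_gt0 => //; exact: mulr_gt0.
  have [|v1 v1N v1z] := H (a%:C *: z + z0) _ _ e'0.
    by rewrite addrK rnormZr gtr0_norm// divfK// gt_eqF.
  have [|v2 v2N v2z] := H z0 _ _ e'0; first by rewrite subrr rnorm0 ltW.
  exists ((a^-1)%:C *: (v1 - v2)).
    have -> : C0 * rnorm z = a^-1 * (2 * N).
      by rewrite /C0 /a; field; rewrite !gt_eqF.
    rewrite rnormZr ger0_norm; last by rewrite invr_ge0 ltW.
    apply: ler_wpM2l; first by rewrite invr_ge0 ltW.
    by apply: le_trans (rnormD _ _) _; rewrite rnormN; lra.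
  have sum4 (A B C D : Z) : A + B - C - (B - D) = A - (C - D).
    by rewrite !opprB [RHS]addrA [LHS](AC (3*2) ((1*4*3)*(2*5))) /= subrr addr0.
  have -> : z - U ((a^-1)%:C *: (v1 - v2)) =
      (a^-1)%:C *: ((a%:C *: z + z0 - U v1) - (z0 - U v2)).
    rewrite sum4 linearZ linearB [RHS]scalerBr scalerA -rmorphM /=.
    by rewrite mulVf ?gt_eqF// scale1r.
  rewrite rnormZr ger0_norm; last by rewrite invr_ge0 ltW.
  rewrite mulrC ler_pdivrMr// [leRHS]mulrC.
  by apply: le_trans (rnormD _ _) _; rewrite rnormN; lra.
have C00 : 0 <= C0 by apply: divr_ge0; [exact: mulr_ge0 | exact: ltW].
have [k kV] := cV.
exists (`|k * C0| + 1) => [|z]; first by rewrite ltr_wpDl.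
have [->|/eqP/rnorm_gt0 z_gt0] := eqVneq z 0.
  by exists 0; rewrite ?linear0 ?rnorm0 ?mulr0.
have step : forall p : nat * Z, exists v,
    rnorm v <= C0 * rnorm p.2 /\ rnorm (p.2 - U v) <= rnorm z * 2^-1 ^+ p.1.+1.
  move=> [n y] /=; have [|v ? ?] := approx y (rnorm z * 2^-1 ^+ n.+1);
    last by exists v.
  by rewrite mulr_gt0// half_exp_gt0.
have [f fP] := choice step.
pose p n := iteri n
  (fun k q => (q.1 + f (k, q.2), q.2 - U (f (k, q.2)))) (0 : V, z).
have p2 n : rnorm (p n).2 <= rnorm z * 2^-1 ^+ n.
  by case: n => [|n]; [rewrite expr0 mulr1 | case: (fP (n, (p n).2))].
have p1 n : rnorm ((p n.+1).1 - (p n).1) <= C0 * rnorm z * 2^-1 ^+ n.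
  rewrite /= -/(p n) addrC addKr; apply: le_trans (fP (n, (p n).2)).1 _.
  by rewrite -mulrA ler_wpM2l// p2.
have pU n : U (p n).1 + (p n).2 = z.
  elim: n => [|n IH]; first by rewrite /= linear0 add0r.
  by rewrite -[RHS]IH /= -/(p n) linearD /= -addrA; congr (_ + _);
    rewrite addrC subrK.
have [v vP] := kV _ _ p1.
exists v; last first.
  have := vP 0%N; rewrite /= subr0 expr0 mulr1 mulrA => h; apply: le_trans h _.
  rewrite ler_wpM2r ?rnorm_ge0//; apply: le_trans (ler_norm _) _;
    rewrite lerDl//.
apply/eqP; rewrite -subr_eq0; apply/eqP.
apply: (@eq0_geometric _ _ _ (`|M| * `|k * (C0 * rnorm z)| + rnorm z)) => n.
have -> : U v - z = U (v - (p n).1) - (p n).2.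
  by rewrite -[in LHS](pU n) opprD addrA linearB.
apply: le_trans (rnormD _ _) _; rewrite rnormN mulrDl.
apply: lerD; last exact: p2.
apply: le_trans (UM _) _.
rewrite -mulrA; apply: (@le_trans _ _ (`|M| * rnorm (v - (p n).1))).
  by rewrite ler_wpM2r ?rnorm_ge0// ler_norm.
apply: ler_wpM2l => //; apply: le_trans (vP n) _.
by rewrite ler_wpM2r ?ler_norm// ltW// half_exp_gt0.
Qed.

End OpenMapping.

(** * Finite-rank operators *)

Section FiniteRank.
Context {R : realType} {Z : normedModType R[i]}.
Local Open Scope complex_scope.
Implicit Types (G T : bop Z Z) (s : seq (bop Z R[i]^o * Z)).

Definition finite_rank G := exists s,
  forall x, G x = \sum_(p <- s) (p.1 x : R[i]) *: p.2.

Lemma finite_rank0 : finite_rank (0 : bop Z Z).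
Proof. by exists [::] => x; rewrite big_nil. Qed.

Lemma finite_rankD G1 G2 :
  finite_rank G1 -> finite_rank G2 -> finite_rank (G1 + G2).
Proof.
by move=> [s1 E1] [s2 E2]; exists (s1 ++ s2) => x; rewrite big_cat -E1 -E2.
Qed.

Lemma finite_rank_compl T G : finite_rank G -> finite_rank (bop_comp T G).
Proof.
move=> [s E]; exists [seq (p.1, T p.2) | p <- s] => x.
rewrite big_map /= E linear_sum; apply: eq_bigr => p _; exact: linearZ.
Qed.

Lemma finite_rankN G : finite_rank G -> finite_rank (- G).
Proof.
move=> [s E]; exists [seq (p.1, - p.2) | p <- s] => x.
rewrite big_map -[LHS]/(- G x) E -sumrN; apply: eq_bigr => p _.
by rewrite scalerN.
Qed.

Lemma rank_one_bop (f : bop Z R[i]^o) (z : Z) :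
  exists T : bop Z Z, forall x, T x = (f x : R[i]) *: z.
Proof.
have [M M0 fM] := bop_bounded f.
apply: (@bop_of _ _ _ _ (M * rnorm z)) => [a x y|x].
  by rewrite linearP scalerDl scalerA.
by rewrite rnormZ mulrAC ler_wpM2r ?rnorm_ge0//; exact: fM.
Qed.

Lemma finite_rank_rank_one (f : bop Z R[i]^o) (z : Z) :
  exists2 G, finite_rank G & forall x, G x = (f x : R[i]) *: z.
Proof.
have [G GE] := rank_one_bop f z; exists G => //.
by exists [:: (f, z)] => x; rewrite big_seq1 GE.
Qed.

Section Alternative.
Variables (n : nat) (f : 'I_n -> bop Z R[i]^o) (y : 'I_n -> Z).
Let g x := \sum_i (f i x : R[i]) *: y i.
Let B : 'M[R[i]]_n := \matrix_(i, j) f j (y i).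
Let c x : 'rV[R[i]]_n := \row_j f j x.
Let e (v : 'rV[R[i]]_n) := \sum_i v 0 i *: y i.

Let cD x z : c (x + z) = c x + c z.
Proof. by apply/rowP => j; rewrite !mxE linearD. Qed.

Let ce v : c (e v) = v *m B.
Proof.
apply/rowP => j; rewrite !mxE linear_sum; apply: eq_bigr => i _.
by rewrite !mxE linearZ.
Qed.

Let ge x : g x = e (c x).
Proof. by apply: eq_bigr => i _; rewrite mxE. Qed.

Let eD v w : e (v + w) = e v + e w.
Proof. by rewrite -big_split; apply: eq_bigr => i _; rewrite mxE scalerDl. Qed.

Let eN v : e (- v) = - e v.
Proof. by rewrite -sumrN; apply: eq_bigr => i _; rewrite mxE scaleNr. Qed.

(* With g = e o c and B the matrix of c o e, id + g is invertible exactly when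
   1 + B is. *)
Lemma alternative_inj :
  (forall x, x + g x = 0 -> x = 0) -> forall z, exists x, x + g x = z.
Proof.
move=> inj; have uB : 1%:M + B \in unitmx.
  rewrite -row_free_unit -kermx_eq0; apply/rowV0P => v /sub_kermxP.
  rewrite mulmxDr mulmx1 -ce => vB.
  have ev0 : e v = 0 by apply: inj; rewrite ge -eD vB /e big1// => i _;
    rewrite mxE scale0r.
  have c0 : c 0 = 0 by apply/rowP => j; rewrite !mxE linear0.
  by move: vB; rewrite ev0 c0 addr0.
move=> z; pose w := c z *m invmx (1%:M + B); exists (z - e w).
have wE : w + w *m B = c z by rewrite -[X in X + _]mulmx1 -mulmxDr mulmxKV.
have cx : c (z - e w) = w by rewrite cD -eN ce mulNmx -wE addrK.
by rewrite ge cx subrK.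
Qed.

(** A column killed by 1 + B is annihilated by every coordinate row c(x + g x), hence by every [c z]
    by surjectivity. The rows c(y i) are those of B, so B kills the column too, and the column is
    zero. *)
Lemma alternative_surj :
  (forall z, exists x, x + g x = z) -> forall x, x + g x = 0 -> x = 0.
Proof.
move=> surj; have uB : 1%:M + B \in unitmx.
  rewrite -unitmx_tr -row_free_unit -kermx_eq0;
    apply/rowV0P => v /sub_kermxP vB.
  have {}vB : (1%:M + B) *m v^T = 0 by apply: trmx_inj;
    rewrite trmx_mul trmxK vB trmx0.
  have Bv : B *m v^T = - v^T.
    by move: vB; rewrite mulmxDl mul1mx addrC => /eqP; rewrite addr_eq0 => /eqP.
  have cv z : c z *m v^T = 0.
    have [x <-] := surj z; rewrite cD ge ce mulmxDl -mulmxA Bv mulmxN.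
    by rewrite subrr.
  apply: trmx_inj; rewrite trmx0; apply/eqP; rewrite -oppr_eq0 -Bv;
    apply/eqP/matrixP => i j.
  rewrite [RHS]mxE -(_ : (c (y i) *m v^T) 0 j = 0); last by rewrite cv mxE.
  by rewrite [LHS]mxE [RHS]mxE; apply: eq_bigr => k _; rewrite !mxE.
move=> x; rewrite ge => x0.
have cx : c x = 0.
  have : c x *m (1%:M + B) = 0.
    rewrite mulmxDr mulmx1 -ce -cD x0; apply/rowP => j; by rewrite !mxE linear0.
  by move=> /(congr1 (mulmx^~ (invmx (1%:M + B)))); rewrite mulmxK// mul0mx.
move: x0; rewrite cx /e big1 ?addr0// => i _; by rewrite mxE scale0r.
Qed.

End Alternative.

Lemma finite_rank_ord G : finite_rank G ->
  exists n (f : 'I_n -> bop Z R[i]^o) y,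
    forall x, G x = \sum_i (f i x : R[i]) *: y i.
Proof.
move=> [s E]; pose p0 := (0 : bop Z R[i]^o, 0 : Z).
exists (size s), (fun i : 'I_(size s) => (nth p0 s i).1),
  (fun i : 'I_(size s) => (nth p0 s i).2) => x.
by rewrite E (big_nth p0) big_mkord.
Qed.

Definition bop_invertible T := exists S : bop Z Z, cancel T S /\ cancel S T.

(* For a Banach space these are the Fredholm operators of index 0. *)
Definition index0 T := exists V G : bop Z Z,
  [/\ bop_invertible V, finite_rank G & forall x, T x = V x + G x].

Lemma index0D T G : index0 T -> finite_rank G -> index0 (T + G).
Proof.
move=> [V [G' [iV fG' TE]]] fG; exists V, (G' + G); split=> // [|x].
  exact: finite_rankD.
by rewrite -[LHS]/(T x + G x) TE -addrA.
Qed.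

Lemma invertible_index0 T G :
  bop_invertible (T + G) -> finite_rank G -> index0 T.
Proof.
move=> iTG fG; exists (T + G), (- G); split=> // [|x];
  first exact: finite_rankN.
by rewrite -[in RHS]/(T x + G x - G x) addrK.
Qed.

(** Composing with the inverse of [V] leaves the identity plus a finite-rank operator, to which the
    matrix alternative applies. *)
Lemma index0_inj_surj T : index0 T ->
  (forall x, T x = 0 -> x = 0) -> forall z, exists x, T x = z.
Proof.
move=> [V [G [[V' [VK V'K]] fG TE]]] inj z.
have [n [f [y GE]]] := finite_rank_ord (finite_rank_compl V' fG).
have [|x xE] := alternative_inj (f := f) (y := y) _ (V' z).
  move=> x; rewrite -GE /= => x0; apply: inj.
  by rewrite TE -[G x]V'K -linearD /= x0 linear0.
by exists x; rewrite TE -[G x]V'K -linearD /= [V' (G x)]GE xE V'K.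
Qed.

Lemma index0_surj_inj T : index0 T ->
  (forall z, exists x, T x = z) -> forall x, T x = 0 -> x = 0.
Proof.
move=> [V [G [[V' [VK V'K]] fG TE]]] surj.
have [n [f [y GE]]] := finite_rank_ord (finite_rank_compl V' fG).
move=> x Tx0; apply: (alternative_surj (f := f) (y := y)) => [z|].
  have [u uz] := surj (V z); exists u; rewrite -GE /=.
  by rewrite -{1}[u]VK -linearD /= -TE uz VK.
by rewrite -GE /= -{1}[x]VK -linearD /= -TE Tx0 linear0.
Qed.

End FiniteRank.

(** * Stability of operators of index zero *)

Section Perturbation.
Context {R : realType} {Z : normedModType R[i]}.
Hypothesis cZ : geo_complete Z.
Local Open Scope complex_scope.
Implicit Types (T G K V W A B S : bop Z Z).

(** The iterates of x -> z - E x from 0 are the partial sums of the Neumann series of (1 + E)^-1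
    z. *)
Lemma neumann (E : bop Z Z) :
  (forall x, rnorm (E x) <= 2^-1 * rnorm x) -> forall z, exists x, x + E x = z.
Proof.
move=> Eh z; pose u n := iter n (fun x => z - E x) 0.
have EB x y : E (x - y) = E x - E y by exact: linearB.
have E0 : E 0 = 0 by exact: linear0.
have uS n : u n.+1 = z - E (u n) by [].
have ug n : rnorm (u n.+1 - u n) <= rnorm z * 2^-1 ^+ n.
  elim: n => [|n IH]; first by rewrite /u /= E0 !subr0 expr0 mulr1.
  have -> : u n.+2 - u n.+1 = - E (u n.+1 - u n).
    by rewrite EB uS [X in _ - X]uS !opprB [LHS]addrC addrA subrK.
  by rewrite rnormN exprS mulrCA; apply: le_trans (Eh _) _;
    rewrite ler_wpM2l// invr_ge0.
have [k kZ] := cZ; have [x xP] := kZ _ _ ug; exists x.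
apply/eqP; rewrite -subr_eq0; apply/eqP.
apply: (@eq0_geometric _ _ _ (2 * `|k * rnorm z|)) => n.
have -> : x + E x - z = (x - u n.+1) + E (x - u n).
  rewrite EB uS opprB; set a := E x; set b := E (u n).
  by rewrite [RHS]addrACA; congr (_ + _); rewrite addrAC subrr add0r.
apply: le_trans (rnormD _ _) _.
have h m : rnorm (x - u m) <= `|k * rnorm z| * 2^-1 ^+ m.
  by apply: le_trans (xP m) _; rewrite ler_wpM2r ?ler_norm// ltW// half_exp_gt0.
have := h n; have := h n.+1; have := Eh (x - u n).
have := mulr_ge0 (normr_ge0 (k * rnorm z)) (ltW (half_exp_gt0 (R := R) n)).
by rewrite exprS; set p := `|_|; set q := 2^-1 ^+ n; rewrite mulrCA; lra.
Qed.

Lemma bounded_below_invertible T (c : R) : 0 < c ->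
  (forall x, c * rnorm x <= rnorm (T x)) -> (forall z, exists x, T x = z) ->
  bop_invertible T.
Proof.
move=> c0 Tc /choice[f fP].
have inj x y : T x = T y -> x = y.
  move=> Txy; apply/eqP; rewrite -subr_eq0; apply/eqP/rnorm_eq0/eqP.
  rewrite eq_le rnorm_ge0 andbT -(pmulr_rle0 _ c0).
  by apply: le_trans (Tc _) _; rewrite linearB /= Txy subrr rnorm0.
have [S SE] : exists S : bop Z Z, forall x, S x = f x.
  apply: (@bop_of _ _ _ _ c^-1) => [a x y|x].
    by apply: inj; rewrite linearP /= !fP.
  by rewrite ler_pdivlMl// -{2}(fP x).
by exists S; split=> x; rewrite SE ?fP//; apply: inj; rewrite fP.
Qed.

Lemma invertible_perturb V W (c : R) : bop_invertible V -> 0 < c ->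
  (forall x, c * rnorm x <= rnorm (V x)) ->
  (forall x, rnorm (W x - V x) <= c / 2 * rnorm x) -> bop_invertible W.
Proof.
move=> [V' [VK V'K]] c0 Vc WV.
apply: (@bounded_below_invertible _ (c / 2)) => [|x|z]; first by lra.
  have := rnormD (W x) (V x - W x); rewrite addrC subrK (rnormBC (V x)).
  have := Vc x; have := WV x; lra.
have [x|x xE] := @neumann (bop_comp V' (W - V)) _ (V' z).
- change (rnorm (V' (W x - V x)) <= 2^-1 * rnorm x).
  have := Vc (V' (W x - V x)); rewrite V'K => h.
  rewrite -(ler_pM2l c0); apply: le_trans h _; apply: le_trans (WV x) _.
  by rewrite mulrA.
- change (x + V' (W x - V x) = V' z) in xE.
  by exists x; move: xE => /(congr1 V); rewrite linearD /= !V'K addrC subrK.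
Qed.

(** A + G has index zero and is bounded below by 7c/8, hence is injective, surjective and
    invertible. B + G differs from it by at most c/4, less than half of 7c/8, so it is invertible as
    well, and B is that operator minus G. *)
Lemma index0_near_bounded_below T G (c : R) A B : finite_rank G -> 0 < c ->
  (forall x, c * rnorm x <= rnorm (T x + G x)) ->
  (forall x, rnorm (A x - T x) <= c / 8 * rnorm x) ->
  (forall x, rnorm (B x - T x) <= c / 8 * rnorm x) ->
  index0 A -> index0 B.
Proof.
move=> fG c0 TGc AT BT iA.
have AGc x : c * (7 / 8) * rnorm x <= rnorm ((A + G) x).
  rewrite -[(A + G) x]/(A x + G x).
  have := rnormD (A x + G x) (T x - A x).
  rewrite [A x + G x + _](_ : _ = T x + G x); last first.
    by rewrite [LHS](AC (2*2) ((3*2)*(1*4))) /= subrr addr0.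
  have := TGc x; have := AT x; rewrite (rnormBC (A x)); lra.
have c7 : 0 < c * (7 / 8) by lra.
have iAG : bop_invertible (A + G).
  apply: (bounded_below_invertible c7 AGc); apply: index0_inj_surj.
    exact: index0D.
  move=> x x0; apply: rnorm_eq0; apply/eqP; rewrite eq_le rnorm_ge0 andbT.
  by rewrite -(pmulr_rle0 _ c7); apply: le_trans (AGc x) _; rewrite x0 rnorm0.
apply: (@invertible_index0 _ _ _ G) => //.
apply: (invertible_perturb iAG c7 AGc) => x.
have -> : (B + G) x - (A + G) x = (B x - T x) - (A x - T x).
  rewrite -[(B + G) x]/(B x + G x) -[(A + G) x]/(A x + G x).
  by rewrite opprD opprB addrACA subrr addr0 addrA subrK.
apply: le_trans (rnormD _ _) _; rewrite rnormN.
have := AT x; have := BT x; have := mulr_ge0 (ltW c0) (rnorm_ge0 x); lra.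
Qed.

(** For C near T, (C + G) S is within 1/2 of the identity, hence onto and bounded below. For A,
    surjectivity of A + G forces its injectivity, and therefore S is onto. As S does not depend on
    A, this makes B + G bounded below and onto. *)
Lemma index0_near_right_invertible T G S (M : R) A B : finite_rank G -> 0 < M ->
  (forall x, rnorm (S x) <= M * rnorm x) ->
  (forall x, T (S x) + G (S x) = x) ->
  (forall x, rnorm (A x - T x) <= M^-1 / 2 * rnorm x) ->
  (forall x, rnorm (B x - T x) <= M^-1 / 2 * rnorm x) ->
  index0 A -> index0 B.
Proof.
move=> fG M0 SM TGS AT BT iA.
have near (C : bop Z Z) : (forall x, rnorm (C x - T x) <= M^-1 / 2 * rnorm x) ->
    (forall x, rnorm x <= 2 * rnorm ((C + G) (S x))) /\
    (forall z, exists x, (C + G) (S x) = z).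
  move=> CT.
  have CE x : (C + G) (S x) = x + (C (S x) - T (S x)).
    rewrite -[LHS]/(C (S x) + G (S x)).
    transitivity ((T (S x) + G (S x)) + (C (S x) - T (S x)));
      last by rewrite TGS.
    by rewrite [RHS](AC (2*2) ((1*4)*(3*2))) /= subrr add0r.
  have CS x : rnorm (C (S x) - T (S x)) <= 2^-1 * rnorm x.
    apply: le_trans (CT _) _;
      rewrite -(ler_pM2l M0) !mulrA mulfV ?gt_eqF// mul1r.
    by have := SM x; lra.
  split=> [x|z].
    have := rnormD (x + (C (S x) - T (S x))) (- (C (S x) - T (S x))).
    by rewrite addrK -CE rnormN; have := CS x; lra.
  have [x <-] := @neumann (bop_comp (C - T) S) CS z.
  by exists x; rewrite CE.
have [A2 Asurj] := near A AT; have [B2 Bsurj] := near B BT.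
have injA : forall x, (A + G) x = 0 -> x = 0.
  apply: index0_surj_inj; first exact: index0D.
  by move=> z; have [x <-] := Asurj z; exists (S x).
(* Since A + G is injective, any u with (A + G)(S u) = (A + G) z satisfies S u = z. *)
have Ssurj z : exists x, S x = z.
  have [x xE] := Asurj ((A + G) z); exists x; apply/eqP; rewrite -subr_eq0.
  by apply/eqP/injA; rewrite linearB; apply/eqP; rewrite subr_eq0; apply/eqP;
    exact: xE.
apply: (@invertible_index0 _ _ _ G) => //.
apply: (@bounded_below_invertible _ (2 * M)^-1) => [|x|z].
- by rewrite invr_gt0; lra.
- have [u <-] := Ssurj x; rewrite ler_pdivrMl; last by lra.
  apply: le_trans (SM u) _; rewrite -mulrA [leRHS]mulrCA.
  by apply: ler_wpM2l; [exact: ltW | exact: B2].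
- by have [x xE] := Bsurj z; exists (S x).
Qed.

(** This stands for a closed subspace of finite codimension; the list of functionals supports
    induction on the codimension. *)
Definition common_kernel (fs : seq (bop Z R[i]^o)) : set Z :=
  [set x | forall f, f \in fs -> f x = 0].

Lemma common_kernel_lim fs (u : nat -> Z) x (C : R) :
  (forall n, common_kernel fs (u n)) ->
  (forall n, rnorm (x - u n) <= C * 2^-1 ^+ n) -> common_kernel fs x.
Proof.
move=> uk ux f ffs; have [M M0 fM] := bop_bounded f.
apply: (@eq0_geometric _ _ _ (M * C)) => n.
have -> : f x = f (x - u n) by rewrite linearB /= (uk n f ffs) subr0.
by apply: le_trans (fM _) _; rewrite -mulrA ler_pM2l.
Qed.

Lemma common_kernelB fs x y :
  common_kernel fs x -> common_kernel fs y -> common_kernel fs (x - y).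
Proof. by move=> kx ky f ffs; rewrite linearB /= kx// ky// subr0. Qed.

Lemma common_kernelZ fs (a : R[i]) x :
  common_kernel fs x -> common_kernel fs (a *: x).
Proof. by move=> kx f ffs; rewrite linearZ /= kx// scaler0. Qed.

(** Were the distance from z to the image zero, the lower bound on T would make approximate
    preimages of z a geometric sequence, whose limit in the kernel would map to z. Homogeneity then
    extends the estimate to all multiples of z. *)
Lemma image_kernel_distance fs T (c : R) z : 0 < c ->
  (forall x, common_kernel fs x -> c * rnorm x <= rnorm (T x)) ->
  (forall x, common_kernel fs x -> T x <> z) ->
  exists2 d : R, 0 < d &
    forall x (a : R[i]), common_kernel fs x ->
      d * cabs a <= rnorm (T x + a *: z).
Proof.
move=> c0 Tc zT.
suff [d d0 dP] : exists2 d : R, 0 < d &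
    forall x, common_kernel fs x -> d <= rnorm (T x - z).
  exists d => // x a kx; have [->|a0] := eqVneq a 0.
    by rewrite /cabs rnorm0 mulr0 rnorm_ge0.
  have -> : T x + a *: z = (- a) *: (T ((- a)^-1 *: x) - z).
    rewrite linearZ scalerBr scalerA mulfV ?oppr_eq0// scale1r.
    by rewrite scaleNr opprK.
  rewrite rnormZ cabsN mulrC ler_wpM2l ?cabs_ge0//; apply: dP.
  exact: common_kernelZ.
apply: contrapT => H.
have step : forall n : nat, exists x,
    common_kernel fs x /\ rnorm (T x - z) < c / 2 * 2^-1 ^+ n.
  move=> n; apply: contrapT => H1; apply: H; exists (c / 2 * 2^-1 ^+ n).
    by apply: mulr_gt0; [lra | exact: half_exp_gt0].
  by move=> x kx; rewrite leNgt; apply/negP => ?; apply: H1; exists x.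
have [u uP] := choice step; have uk n := (uP n).1.
have ug n : rnorm (u n.+1 - u n) <= 1 * 2^-1 ^+ n.
  rewrite mul1r -(ler_pM2l c0).
  apply: le_trans (Tc _ (common_kernelB (uk _) (uk _))) _.
  rewrite linearB /=; have := rnorm_tri z (T (u n.+1)) (T (u n)).
  rewrite (rnormBC z); have := (uP n).2; have := (uP n.+1).2.
  rewrite exprS; have := mulr_gt0 c0 (half_exp_gt0 (R := R) n).
  set q := 2^-1 ^+ n; nra.
have [k kZ] := cZ; have [x xP] := kZ _ _ ug.
apply: (zT x (common_kernel_lim uk xP)).
have [M M0 TM] := bop_bounded T.
apply/eqP; rewrite -subr_eq0; apply/eqP.
apply: (@eq0_geometric _ _ _ (M * (k * 1) + c / 2)) => n.
have -> : T x - z = T (x - u n) + (T (u n) - z).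
  by rewrite linearB /= addrA subrK.
apply: le_trans (rnormD _ _) _; rewrite mulrDl lerD ?(ltW (uP n).2)//.
by apply: le_trans (TM _) _; rewrite -mulrA ler_pM2l.
Qed.

(* One functional is removed at a time: if T maps the common kernel onto Z, then
   T is right invertible; otherwise a rank-one perturbation of T sends a vector
   complementary to that kernel outside of its image, which is closed. *)
Lemma finite_rank_dichotomy fs T (c : R) : 0 < c ->
  (forall x, common_kernel fs x -> c * rnorm x <= rnorm (T x)) ->
  exists2 G, finite_rank G &
    (exists2 c' : R, 0 < c' & forall x, c' * rnorm x <= rnorm (T x + G x)) \/
    (exists S : bop Z Z, forall x, T (S x) + G (S x) = x).
Proof.
elim: fs T c => [|f fs IH] T c c0 Tc.
  exists 0; first exact: finite_rank0.
  left; exists c => // x; have -> : T x + (0 : bop Z Z) x = T x.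
    by rewrite -[LHS]/(T x + 0) addr0.
  exact: Tc.
have [[e [ke fe]]|H] := pselect (exists e, common_kernel fs e /\ f e = 1);
  last first.
  apply: (IH T c c0) => x kx; apply: Tc => g; rewrite inE => /orP[/eqP->|];
    last exact: kx.
  apply: contrapT => fx; apply: H; exists ((f x)^-1 *: x); split.
    exact: common_kernelZ.
  by rewrite linearZ /=; apply: mulVf; apply/eqP.
have kcons x : common_kernel fs x -> f x = 0 -> common_kernel (f :: fs) x.
  by move=> kx fx g; rewrite inE => /orP[/eqP->|]; [exact: fx | exact: kx].
have [surj|] := pselect
    (forall z, exists2 x, common_kernel (f :: fs) x & T x = z).
  have inj x y : common_kernel (f :: fs) x -> common_kernel (f :: fs) y ->
      T x = T y -> x = y.
    move=> kx ky Txy; apply/eqP; rewrite -subr_eq0; apply/eqP/rnorm_eq0/eqP.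
    rewrite eq_le rnorm_ge0 andbT -(pmulr_rle0 _ c0).
    by apply: le_trans (Tc _ (common_kernelB kx ky)) _;
      rewrite linearB /= Txy subrr rnorm0.
  have /choice[s sP] : forall z, exists x, common_kernel (f :: fs) x /\ T x = z.
    by move=> z; have [x ? ?] := surj z; exists x.
  have [S SE] : exists S : bop Z Z, forall x, S x = s x.
    apply: (@bop_of _ _ _ _ c^-1) => [a x y|x].
      apply: inj; first exact: (sP _).1.
        have := common_kernelB (common_kernelZ a (sP x).1)
          (common_kernelZ (-1) (sP y).1).
        by rewrite scaleN1r opprK.
      by rewrite linearP /= !(sP _).2.
    by rewrite ler_pdivlMl// -{2}(sP x).2; apply: Tc; exact: (sP x).1.
  exists 0; first exact: finite_rank0.
  by right; exists S => x; rewrite -[LHS]/(T (S x) + 0) addr0 SE (sP x).2.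
move=> /existsNP[z zT].
have [|d d0 dP] := @image_kernel_distance (f :: fs) T c z c0 Tc.
  by move=> x kx Tx; apply: zT; exists x.
(* T + G1 agrees with T on the kernel of f and sends e to z. *)
have [G1 fG1 G1E] := finite_rank_rank_one f (z - T e).
(* Write x = m + f(x) e with f(m) = 0, and w = T m + f(x) z. Then |f x| <= |w| / d bounds the part
   along e, and |m| <= c^-1 |T m| bounds the rest; C is the sum of the two contributions. *)
pose C := c^-1 * (1 + rnorm z / d) + rnorm e / d.
have C0 : 0 < C.
  rewrite ltr_wpDr ?divr_ge0 ?rnorm_ge0 ?(ltW d0)//.
  by rewrite mulr_gt0 ?invr_gt0// ltr_wpDr ?divr_ge0 ?rnorm_ge0 ?(ltW d0).
have Ci0 : 0 < C^-1 by rewrite invr_gt0.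
have [|G fG GP] := IH (T + G1) C^-1 Ci0.
  move=> x kx; rewrite ler_pdivrMl//.
  pose m := x - (f x : R[i]) *: e.
  have km : common_kernel (f :: fs) m.
    apply: kcons; first by apply: common_kernelB => //; exact: common_kernelZ.
    rewrite linearB linearZ /= fe; apply/eqP; rewrite subr_eq0; apply/eqP.
    by rewrite -[RHS]/(f x * 1) mulr1.
  have -> : (T + G1) x = T m + (f x : R[i]) *: z.
    have -> : T m = T x - (f x : R[i]) *: T e by rewrite linearB linearZ.
    by rewrite -[LHS]/(T x + G1 x) G1E scalerBr addrA addrAC.
  set w := T m + _; have dw := dP m (f x) km; rewrite -/w in dw.
  have fxd : cabs (f x) <= rnorm w / d by rewrite ler_pdivlMr// mulrC.
  have Tm : rnorm (T m) <= rnorm w * (1 + rnorm z / d).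
    have := rnormD w (- ((f x : R[i]) *: z)); rewrite addrK rnormN rnormZ => h.
    apply: le_trans h _; rewrite mulrDr mulr1 lerD2l mulrA mulrAC.
    by rewrite ler_wpM2r ?rnorm_ge0.
  have nm : rnorm m <= c^-1 * (rnorm w * (1 + rnorm z / d)).
    by rewrite ler_pdivlMl//; apply: le_trans (Tc m km) Tm.
  have xE : x = m + (f x : R[i]) *: e by rewrite /m subrK.
  rewrite {1}xE; apply: le_trans (rnormD _ _) _; rewrite rnormZ.
  have h2 : cabs (f x) * rnorm e <= rnorm w / d * rnorm e.
    by rewrite ler_wpM2r ?rnorm_ge0.
  apply: le_trans (lerD nm h2) _; rewrite le_eqVlt; apply/orP; left; apply/eqP.
  by rewrite /C; field; rewrite !gt_eqF.
exists (G1 + G); first exact: finite_rankD.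
case: GP => [[c' c'0 GP]|[S SP]].
  by left; exists c' => // x; have := GP x; rewrite -addrA.
by right; exists S => x; have := SP x; rewrite -addrA.
Qed.

End Perturbation.

(** * Strictly singular perturbations of the identity *)

Section TriangularSequences.
Context {R : realType} {Z : normedModType R[i]}.
Local Open Scope complex_scope.

Lemma has_dim_dependent (K : fieldType) (V : lmodType K) (W : set V) n
    (v : 'I_n.+1 -> V) : has_dim W n -> (forall i, W (v i)) ->
  exists2 w : 'rV[K]_n.+1, w != 0 & \sum_i w 0 i *: v i = 0.
Proof.
move=> [e [_ eW]] vW.
have /choice[c cP] : forall i, exists c : 'rV[K]_n, v i = \sum_j c 0 j *: e j.
  move=> i; have [c [/= cE _]] := eW _ (vW i); exists c.
  by apply/eqP; rewrite -subr_eq0; apply/eqP.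
pose A : 'M[K]_(n.+1, n) := \matrix_i c i.
have : kermx A != 0.
  rewrite kermx_eq0 /row_free; apply/eqP => rA.
  by have := rank_leq_col A; rewrite rA ltnn.
move=> /rowV0Pn[w /sub_kermxP wA w0]; exists w => //.
under eq_bigr => i _ do rewrite cP scaler_sumr.
rewrite exchange_big big1// => j _.
under eq_bigr => i _ do rewrite scalerA.
rewrite -scaler_suml.
have -> : \sum_i w 0 i * c i 0 j = (w *m A) 0 j.
  by rewrite mxE; apply: eq_bigr => i _; rewrite !mxE.
by rewrite wA mxE scale0r.
Qed.

(* Triangularity of f with respect to x bounds the coordinates of a combination
   of the x k by 2 ^ k times its norm, so no basic sequence is needed. *)
Variables (x : nat -> Z) (f : nat -> bop Z R[i]^o).
Hypotheses (x1 : forall n, rnorm (x n) = 1)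
  (f1 : forall n y, cabs (f n y) <= rnorm y) (fx1 : forall n, f n (x n) = 1)
  (fx0 : forall j n, (j < n)%N -> f j (x n) = 0).

Definition span_seq : set Z := [set z | exists N (c : nat -> R[i]),
  (forall k, (N <= k)%N -> c k = 0) /\ z = \sum_(0 <= k < N) c k *: x k].

Lemma span_seq_widen N N' (c : nat -> R[i]) :
  (forall k, (N <= k)%N -> c k = 0) ->
  (N <= N')%N -> \sum_(0 <= k < N') c k *: x k = \sum_(0 <= k < N) c k *: x k.
Proof.
move=> c0 NN'; rewrite (big_cat_nat (leq0n N) NN')//=
  [X in _ + X]big_nat_cond [X in _ + X]big1 ?addr0//.
by move=> k /andP[/andP[Nk _] _]; rewrite c0// scale0r.
Qed.

Lemma span_seq_subspace : linear_subspace span_seq.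
Proof.
split; first by exists 0%N, (fun=> 0); rewrite big_nil.
move=> a _ _ [N [c [c0 ->]]] [N' [c' [c'0 ->]]].
exists (N + N')%N, (fun k => a * c k + c' k); split=> [k NNk|].
  rewrite c0 ?c'0 ?mulr0 ?addr0//; first exact: leq_trans (leq_addl N N') NNk.
  exact: leq_trans (leq_addr N' N) NNk.
rewrite -(span_seq_widen c0 (leq_addr N' N)).
rewrite -(span_seq_widen c'0 (leq_addl N N')).
rewrite scaler_sumr -big_split; apply: eq_bigr => k _ /=.
by rewrite scalerDl scalerA.
Qed.

(** Applied to the tail of the sum from index m on, [f m] returns exactly [c m], since it kills the
    later vectors. So |c m| is at most the norm of that tail, and removing the term c m x m at most
    doubles this norm. *)
Lemma coord_bound N (c : nat -> R[i]) k : (k < N)%N ->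
  cabs (c k) <= 2 ^+ k * rnorm (\sum_(0 <= j < N) c j *: x j).
Proof.
pose r k := \sum_(k <= j < N) c j *: x j.
have rS m : (m < N)%N -> r m = c m *: x m + r m.+1.
  by move=> mN; rewrite /r big_ltn.
have rc m : (m < N)%N -> c m = f m (r m).
  move=> mN; rewrite /r linear_sum big_ltn//= big_nat_cond big1 ?addr0.
    by rewrite linearZ /= fx1; exact: (esym (mulr1 (c m))).
  by move=> j /andP[/andP[mj _] _]; rewrite linearZ /= fx0// scaler0.
have cr m : (m < N)%N -> cabs (c m) <= rnorm (r m).
  by move=> mN; rewrite (rc m mN); exact: f1.
move=> kN; apply: le_trans (cr k kN) _; rewrite -[\sum_(0 <= j < N) _]/(r 0%N).
elim: k kN => [|k IH] kN; first by rewrite expr0 mul1r.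
have kN' := ltnW kN.
have -> : r k.+1 = r k - c k *: x k by rewrite (rS k kN') addrC addKr.
apply: le_trans (rnormD _ _) _; rewrite rnormN rnormZ x1 mulr1.
by have := IH kN'; have := cr k kN'; rewrite exprS -mulrA; lra.
Qed.

Lemma span_seq_infinite_dim : ~ finite_dim span_seq.
Proof.
move=> [n Wn].
have xW i : span_seq (x i).
  exists i.+1, (fun k => (k == i)%:R); split=> [k ik|].
    by rewrite gtn_eqF.
  rewrite big_nat_recr//= eqxx scale1r big_nat_cond big1 ?add0r//.
  by move=> k /andP[/andP[_ ki] _]; rewrite ltn_eqF// scale0r.
have [w /eqP w0 wx] := has_dim_dependent Wn (fun i : 'I_n.+1 => xW i).
apply: w0; apply/rowP => k; rewrite mxE; apply: cabs_eq0; apply/eqP.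
rewrite eq_le cabs_ge0 andbT.
have := coord_bound (fun k => w 0 (inord k)) (ltn_ord k).
rewrite inord_val big_mkord.
by under eq_bigr => i _ do rewrite inord_val; rewrite wx rnorm0 mulr0.
Qed.

(** One factor 2^-n offsets the growth of the coordinate bounds; the other makes the series
    converge, and 1/4 makes its sum at most 1/2. *)
Lemma span_seq_small (T : bop Z Z) :
  (forall n, rnorm (T (x n)) <= 4^-1 * (2^-1 ^+ n * 2^-1 ^+ n)) ->
  forall z, span_seq z -> rnorm (T z) <= 2^-1 * rnorm z.
Proof.
move=> Tx z [N [c [c0 zE]]]; set s := rnorm z.
have cb k : (k < N)%N -> cabs (c k) <= 2 ^+ k * s.
  by move=> kN; rewrite /s zE; exact: coord_bound.
suff H M : (M <= N)%N ->
    rnorm (T (\sum_(0 <= k < M) c k *: x k)) <= 2^-1 * (1 - 2^-1 ^+ M) * s.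
  rewrite zE; apply: le_trans (H N (leqnn N)) _.
  apply: ler_wpM2r; first exact: rnorm_ge0.
  by have := half_exp_gt0 (R := R) N; lra.
elim: M => [|M IH] MN;
  first by rewrite big_nil linear0 rnorm0 expr0 subrr mulr0 mul0r.
rewrite big_nat_recr//= linearD linearZ /=.
apply: le_trans (rnormD _ _) _; rewrite rnormZ.
have h := IH (ltnW MN).
have : cabs (c M) * rnorm (T (x M)) <= 4^-1 * 2^-1 ^+ M * s.
  apply: le_trans (ler_pM (cabs_ge0 _) (rnorm_ge0 _) (cb M MN) (Tx M)) _.
  rewrite le_eqVlt; apply/orP; left; apply/eqP; rewrite exprVn.
  by field; rewrite expf_neq0.
rewrite exprS; set q := 2^-1 ^+ M in h *; lra.
Qed.

End TriangularSequences.

Section StrictlySingular.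
Context {R : realType}.
Local Open Scope complex_scope.

(** Unit vectors with tiny images are chosen one after another, each in the common kernel of the
    norming functionals of its predecessors; this yields the triangular system. The length of the
    list [fs] serves as the index n. *)
Lemma small_on_infinite_dim (Z : normedModType R[i]) (T : bop Z Z) :
  (forall fs (c : R), 0 < c ->
    exists2 x, common_kernel fs x & rnorm (T x) < c * rnorm x) ->
  exists W : set Z, [/\ linear_subspace W, ~ finite_dim W &
    forall x, W x -> rnorm (T x) <= 2^-1 * rnorm x].
Proof.
move=> H.
have step : forall fs : seq (bop Z R[i]^o), exists p : Z * bop Z R[i]^o,
   [/\ common_kernel fs p.1, rnorm p.1 = 1,
     rnorm (T p.1) <= 4^-1 * (2^-1 ^+ size fs * 2^-1 ^+ size fs),
     forall y, cabs (p.2 y) <= rnorm y & p.2 p.1 = 1].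
  move=> fs; set e := _ * (_ * _ : R).
  have e0 : 0 < e by rewrite mulr_gt0 ?invr_gt0// mulr_gt0// half_exp_gt0.
  have [x kx Tx] := H fs e e0.
  have x0 : 0 < rnorm x.
    rewrite lt_def rnorm_ge0 andbT; apply/eqP => x0; move: Tx.
    by rewrite x0 mulr0 ltNge rnorm_ge0.
  pose u := ((rnorm x)^-1)%:C *: x.
  have u1 : rnorm u = 1.
    by rewrite rnormZr ger0_norm ?invr_ge0 ?rnorm_ge0// mulVf// gt_eqF.
  have [f [f1 fu]] := hahn_banach u.
  exists (u, f); split=> //=; first exact: common_kernelZ.
    rewrite linearZ /= rnormZr ger0_norm ?invr_ge0 ?rnorm_ge0// mulrC.
    by rewrite ler_pdivrMr// ltW.
  by rewrite fu u1.
have [F FP] := choice step.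
pose fs n := iteri n (fun _ s => (F s).2 :: s) [::].
have sfs n : size (fs n) = n by elim: n => //= n ->.
have fsP j n : (j < n)%N -> (F (fs j)).2 \in fs n.
  elim: n => // n IH; rewrite ltnS leq_eqVlt => /orP[/eqP->|/IH jn].
    by rewrite /= inE eqxx.
  by rewrite /= inE jn orbT.
pose x n := (F (fs n)).1; pose f n := (F (fs n)).2.
have x1 n : rnorm (x n) = 1 by case: (FP (fs n)).
have f1 n y : cabs (f n y) <= rnorm y by case: (FP (fs n)).
have fx1 n : f n (x n) = 1 by case: (FP (fs n)).
have fx0 j n : (j < n)%N -> f j (x n) = 0.
  by move=> jn; have [kx _ _ _ _] := FP (fs n); apply: kx; exact: fsP.
exists (span_seq x); split.
- exact: span_seq_subspace.
- exact: (span_seq_infinite_dim x1 f1 fx1 fx0).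
- apply: (span_seq_small x1 f1 fx1 fx0) => n.
  by have [_ _ + _ _] := FP (fs n); rewrite sfs.
Qed.

(** Let t be the supremum of the parameters in [0, 1] up to which [P] holds. Some such parameter
    lies within d of t, so [P] spreads up to t + d, which must then reach 1. The hypothesis compares
    two neighbours of t and does not presuppose [P] at t. *)
Lemma locally_constant_path (P : R -> Prop) :
  (forall t, exists2 d : R, 0 < d &
    forall s s', `|s - t| <= d -> `|s' - t| <= d ->
    P s -> P s') -> P 0 -> P 1.
Proof.
move=> loc P0.
pose A := [set t : R | 0 <= t <= 1 /\ forall s, 0 <= s <= t -> P s].
have A0 : A 0.
  split=> [|s]; first by rewrite lexx ler01.
  by rewrite -eq_le => /eqP <-.
have hA : has_sup A by split; [exists 0 | exists 1 => t [/andP[]]].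
pose t := sup A; have [d d0 dP] := loc t.
have t0 : 0 <= t by apply: (ub_le_sup hA.2).
have [s As ts] := sup_adherent d0 hA; rewrite -/t in ts.
have st : s <= t by exact: (ub_le_sup hA.2).
have Ps : P s by case: As => /andP[s0 _]; apply; rewrite s0 lexx.
have all u : 0 <= u <= t + d -> P u.
  move=> /andP[u0 ut]; have [us|su] := leP u s.
    by case: As => _; apply; rewrite u0 us.
  by apply: (dP s) => //; rewrite ler_norml; apply/andP; split; lra.
have [t1|t1] := leP 1 (t + d); first by apply: all; rewrite ler01.
have : A (t + d) by split=> //; apply/andP; split; lra.
by move=> /(ub_le_sup hA.2); rewrite -/t; lra.
Qed.

Variables (Z : banach R) (K : bop Z Z).
Hypothesis K_ss : strictly_singular Z Z K.

(** Otherwise 1 + t K would at least halve norms on an infinite-dimensional subspace, and K would be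
    bounded below there. *)
Lemma strictly_singular_bounded_below (t : R) :
  exists fs, exists2 c : R, 0 < c &
    forall x, common_kernel fs x -> c * rnorm x <= rnorm ((1 + t%:C *: K) x).
Proof.
apply: contrapT => H.
have [fs c c0|W [Wlin Winf WT]] := @small_on_infinite_dim Z (1 + t%:C *: K).
  apply: contrapT => H1; apply: H; exists fs, c => // x kx.
  by rewrite leNgt; apply/negP => Tx; apply: H1; exists x.
apply: Winf; apply: K_ss => //.
(* The summand 1 keeps the constant positive when t = 0. *)
have t0 : 0 < 2 * `|t| + 1 by have := normr_ge0 t; lra.
exists (2 * `|t| + 1)^-1%:C; first by rewrite ltcR invr_gt0.
move=> x Wx; rewrite -!rnormE -rmorphM lecR ler_pdivrMl//.
have := WT x Wx; rewrite -[(1 + t%:C *: K) x]/(x + t%:C *: K x).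
have := rnormD (x + t%:C *: K x) (- (t%:C *: K x)).
rewrite addrK rnormN rnormZr; have := rnorm_ge0 (K x); lra.
Qed.

Lemma strictly_singular_index0 : index0 (1 + K).
Proof.
have cZ : geo_complete Z by exact: geo_complete_banach.
have [M M0 KM] := bop_bounded K.
have KD t s x :
    rnorm ((1 + s%:C *: K) x - (1 + t%:C *: K) x) <= `|s - t| * M * rnorm x.
  rewrite -[(1 + s%:C *: K) x]/(x + s%:C *: K x).
  rewrite -[(1 + t%:C *: K) x]/(x + t%:C *: K x).
  rewrite opprD addrACA subrr add0r -scalerBl -rmorphB rnormZr -mulrA.
  by rewrite ler_wpM2l.
have KDe t (e : R) s x : `|s - t| <= e / M ->
    rnorm ((1 + s%:C *: K) x - (1 + t%:C *: K) x) <= e * rnorm x.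
  move=> st; apply: le_trans (KD t s x) _; rewrite ler_wpM2r ?rnorm_ge0//.
  by rewrite -ler_pdivlMr.
rewrite -[K]scale1r -(rmorph1 (real_complex R)).
apply: (@locally_constant_path (fun t => index0 (1 + t%:C *: K))); last first.
  rewrite scale0r addr0; exists 1, 0; split=> [||x]; last by rewrite addr0.
    by exists 1; split.
  exact: finite_rank0.
move=> t; have [fs [c c0 cP]] := strictly_singular_bounded_below t.
have [G fG [[c' c'0 GP]|[S SP]]] := finite_rank_dichotomy cZ c0 cP.
  exists (c' / 8 / M) => [|s s' st s't].
    by apply: divr_gt0 => //; lra.
  by apply: (index0_near_bounded_below cZ fG c'0 GP) => x; exact: KDe.
have [N N0 SN] := bop_bounded S.
exists (N^-1 / 2 / M) => [|s s' st s't].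
  by apply: divr_gt0 => //; rewrite divr_gt0// invr_gt0.
by apply: (index0_near_right_invertible cZ fG N0 SN SP) => x; exact: KDe.
Qed.

Lemma strictly_singular_left_inverse (L : bop Z Z) :
  L * (1 + K) = 1 -> (1 + K) * L = 1.
Proof.
move=> LK; have LKE x : L ((1 + K) x) = x.
  by rewrite -[LHS]/((L * (1 + K)) x) LK.
apply: bopP => z.
have [|x <-] := index0_inj_surj strictly_singular_index0 _ z.
  by move=> x x0; rewrite -(LKE x) x0 linear0.
by rewrite -[LHS]/((1 + K) (L ((1 + K) x))) LKE.
Qed.

End StrictlySingular.

(** * Matrices of operators *)

Section Dimension.
Context {K : fieldType} {V : lmodType K}.

(** If some n + 1 vectors are independent they form a basis, because adjoining any u gives a
    dependent family; otherwise n decreases. With [has_dim_dependent] this pulls finite dimension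
    back along an injection without choosing a basis of its image. *)
Lemma finite_dim_of_dependent n :
  (forall v : 'I_n.+1 -> V,
    exists2 w : 'rV[K]_n.+1, w != 0 & \sum_i w 0 i *: v i = 0) ->
  finite_dim [set: V].
Proof.
elim: n => [|n IH] dep.
  apply: finite_dim_trivial => v; have [w w0] := dep (fun=> v).
  rewrite big_ord1 => /eqP; rewrite scaler_eq0 => /orP[|/eqP//] /eqP w00.
  by case/eqP: w0; apply/rowP => i; rewrite ord1 w00 mxE.
have [dep'|/existsNP[v vind]] := pselect (forall v : 'I_n.+1 -> V,
  exists2 w : 'rV[K]_n.+1, w != 0 & \sum_i w 0 i *: v i = 0); first exact: IH.
have vfree (w : 'rV[K]_n.+1) : \sum_i w 0 i *: v i = 0 -> w = 0.
  by move=> wv; apply: contrapT => w0; apply: vind; exists w => //; apply/eqP.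
exists n.+1, v; split=> // u _.
have [w w0] := dep (fun i => if unlift ord0 i is Some j then v j else u).
rewrite big_ord_recl unlift_none; under eq_bigr => i _ do rewrite liftK.
move=> wE; have w00 : w 0 ord0 != 0.
  apply: contra_neq w0 => w00; apply/rowP => i; rewrite mxE.
  case: (unliftP ord0 i) => [j ->|->]; last exact: w00.
  move: wE; rewrite w00 scale0r add0r => wE.
  have /rowP/(_ j) : \row_j w 0 (lift ord0 j) = 0.
    by apply: vfree; rewrite -[RHS]wE; apply: eq_bigr => i' _; rewrite mxE.
  by rewrite !mxE.
exists (\row_j (- (w 0 ord0)^-1 * w 0 (lift ord0 j))); split=> [|c /= cE].
  have -> : \sum_i (\row_j (- (w 0 ord0)^-1 * w 0 (lift ord0 j))) 0 i *: v i =
      - (w 0 ord0)^-1 *: \sum_i w 0 (lift ord0 i) *: v i.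
    by rewrite scaler_sumr; apply: eq_bigr => i _; rewrite mxE scalerA.
  move: wE => /eqP; rewrite addrC addr_eq0 => /eqP ->.
  by rewrite /= scaleNr scalerN opprK scalerA mulVf// scale1r subrr.
apply/eqP; rewrite -subr_eq0; apply/eqP; apply: vfree.
have := wE => /(congr1 (fun z => - (w 0 ord0)^-1 *: z)).
rewrite scaler0 scalerDr scalerA mulNr mulVf// scaleN1r => wE'.
under eq_bigr => i _ do rewrite !mxE scalerBl.
rewrite sumrB; move/eqP: cE; rewrite subr_eq0 => /eqP <-.
rewrite -[RHS]wE' addrC scaler_sumr; congr (_ + _).
by apply: eq_bigr => i _; rewrite scalerA.
Qed.

End Dimension.

Section PowerOperators.
Context {R : realType}.
Local Open Scope complex_scope.

Lemma power_proj_exists (X : normedModType R[i]) N (i : 'I_N) :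
  exists P : bop (power X N) X, forall x, P x = x i.
Proof.
apply: (@bop_of _ _ _ _ 1) => [a x y|x]; first by rewrite !ffunE.
by rewrite mul1r rnorm_power (bigD1 i)//= lerDl sumr_ge0// => j _;
  exact: rnorm_ge0.
Qed.

Lemma power_inj_exists (X : normedModType R[i]) N (i : 'I_N) :
  exists J : bop X (power X N),
    forall x, J x = [ffun j => if j == i then x else 0].
Proof.
apply: (@bop_of _ _ _ _ 1) => [a x y|x].
  by apply/ffunP => j; rewrite !ffunE; case: eqP => // _; rewrite scaler0 addr0.
rewrite mul1r rnorm_power (bigD1 i)//= ffunE eqxx big1 ?addr0// => j /negbTE ji.
by rewrite ffunE ji rnorm0.
Qed.

Definition power_proj (X : normedModType R[i]) N i :=
  sval (cid (@power_proj_exists X N i)).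
Definition power_inj (X : normedModType R[i]) N i :=
  sval (cid (@power_inj_exists X N i)).

Lemma power_projE (X : normedModType R[i]) N i x : @power_proj X N i x = x i.
Proof. exact: (svalP (cid (@power_proj_exists X N i))). Qed.

Lemma power_injE (X : normedModType R[i]) N i x :
  @power_inj X N i x = [ffun j => if j == i then x else 0].
Proof. exact: (svalP (cid (@power_inj_exists X N i))). Qed.

Lemma power_infinite_dim (X : banach R) N : (0 < N)%N ->
  ~ finite_dim [set: power X N].
Proof.
move=> N0 [n Xn]; apply: (@banach_infinite_dim R X).
apply: (@finite_dim_of_dependent _ _ n) => v.
have [w w0 wv] := has_dim_dependent Xn
  (fun i : 'I_n.+1 => I : [set: power X N] (power_inj X (Ordinal N0) (v i))).
exists w => //; move: wv => /(congr1 (power_proj X (Ordinal N0))).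
rewrite linear_sum linear0 => h; apply: etrans h; apply: eq_bigr => i _.
by rewrite linearZ /= power_projE power_injE ffunE eqxx.
Qed.

(** X^N has to be an object of [banach] because ideals and strict singularity are defined between
    such objects only. *)
Definition power_banach (X : banach R) N (N0 : (0 < N)%N) : banach R :=
  Banach (@power_infinite_dim X N N0).

Variables (X : banach R) (N : nat) (N0 : (0 < N)%N).
Let Y : banach R := power_banach X N0.

Definition op_of_mx (M : 'M[bop X X]_N) : bop Y Y :=
  \sum_i \sum_j bop_comp (bop_comp (power_inj X i) (M i j)) (power_proj X j).

Lemma bop_sumE (V W : normedModType R[i]) (J : Type) (r : seq J)
    (F : J -> bop V W) x :
  (\sum_(i <- r) F i) x = \sum_(i <- r) F i x.
Proof. by elim/big_rec2: _ => // i y T _ <-. Qed.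

Lemma op_of_mxE M (x : power X N) i : op_of_mx M x i = \sum_j M i j (x j).
Proof.
rewrite /op_of_mx bop_sumE sum_ffunE (bigD1 i)//= [X in _ + X]big1 ?addr0.
  rewrite bop_sumE sum_ffunE; apply: eq_bigr => j _.
  by rewrite /= power_injE power_projE ffunE eqxx.
move=> k /negbTE ki; rewrite bop_sumE sum_ffunE big1// => j _.
by rewrite /= power_injE ffunE eq_sym ki.
Qed.

Lemma op_of_mxM (M M' : 'M[bop X X]_N) :
  op_of_mx (M *m M') = op_of_mx M * op_of_mx M'.
Proof.
apply: bopP => x; apply/ffunP => i.
rewrite -[(op_of_mx M * op_of_mx M') x]/(op_of_mx M (op_of_mx M' x)) !op_of_mxE.
under eq_bigr => j _ do rewrite mxE bop_sumE.
rewrite exchange_big /=; apply: eq_bigr => k _.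
by rewrite op_of_mxE linear_sum.
Qed.

Lemma op_of_mx1 : op_of_mx 1%:M = 1.
Proof.
apply: bopP => x; apply/ffunP => i; rewrite op_of_mxE (bigD1 i)//= big1 ?addr0.
  by rewrite mxE eqxx.
by move=> j /negbTE ij; rewrite mxE eq_sym ij.
Qed.

Lemma op_of_mxD M M' : op_of_mx (M + M') = op_of_mx M + op_of_mx M'.
Proof.
apply: bopP => x; apply/ffunP => i.
rewrite -[(op_of_mx M + op_of_mx M') x]/(op_of_mx M x + op_of_mx M' x).
rewrite ffunE !op_of_mxE -big_split.
by apply: eq_bigr => j _; rewrite mxE.
Qed.

Definition mx_of_op (T : bop (power X N) (power X N)) : 'M[bop X X]_N :=
  \matrix_(i, j) bop_comp (bop_comp (power_proj X i) T) (power_inj X j).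

Lemma mx_of_opK T : op_of_mx (mx_of_op T) = T.
Proof.
apply: bopP => x; apply/ffunP => i; rewrite op_of_mxE.
have xE : x = \sum_j power_inj X j (x j).
  apply/ffunP => k; rewrite sum_ffunE (bigD1 k)//= big1 ?addr0.
    by rewrite power_injE ffunE eqxx.
  by move=> j /negbTE jk; rewrite power_injE ffunE eq_sym jk.
rewrite [in RHS]xE linear_sum sum_ffunE; apply: eq_bigr => j _.
by rewrite mxE /= power_projE.
Qed.

Lemma op_of_mx_inj : injective op_of_mx.
Proof.
move=> M M' MM'; apply/matrixP => i j; apply: bopP => x.
have := congr1 (fun T : bop Y Y => T (power_inj X j x) i) MM'.
rewrite !op_of_mxE (bigD1 j)//= [X in _ + X]big1 ?addr0; last first.
  by move=> k /negbTE kj; rewrite power_injE ffunE kj linear0.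
rewrite (bigD1 j)//= [X in _ + X]big1 ?addr0; last first.
  by move=> k /negbTE kj; rewrite power_injE ffunE kj linear0.
by rewrite power_injE ffunE eqxx.
Qed.

Section Ideal.
Variable I : op_ideal R.

Lemma op_ideal_sum (V W : banach R) (J : Type) (r : seq J) (F : J -> bop V W) :
  (forall i, I V W (F i)) -> I V W (\sum_(i <- r) F i).
Proof.
move=> IF; elim/big_rec: _ => [|i S _ IS];
  first exact: (op_ideal_subspace I V W).1.
by rewrite -[F i]scale1r; apply: (op_ideal_subspace I V W).2.
Qed.

(** Each entry is composed with a coordinate projection and injection, so the ideal property between
    different spaces is what carries I(X) into I(X^N). *)
Lemma op_of_mx_ideal (M : 'M[bop X X]_N) :
  (forall i j, I X X (M i j)) -> I Y Y (op_of_mx M).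
Proof.
by move=> IM; do 2!apply: op_ideal_sum => ?;
  apply: (@op_ideal_comp _ I Y X X Y).
Qed.

Lemma mx_left_inverse (K L : 'M[bop X X]_N) :
  contained_in I strictly_singular -> (forall i j, I X X (K i j)) ->
  L *m (1%:M + K) = 1%:M -> (1%:M + K) *m L = 1%:M.
Proof.
move=> I_ss IK LK; apply: op_of_mx_inj; rewrite op_of_mxM op_of_mxD op_of_mx1.
apply: strictly_singular_left_inverse; first exact/I_ss/op_of_mx_ideal.
by rewrite -op_of_mx1 -op_of_mxD -op_of_mxM LK.
Qed.

End Ideal.
End PowerOperators.

(** * Lifting invertibility modulo the ideal through a splitting *)

Section Splitting.
Context {R : realType} (X : banach R) (I : op_ideal R).
Hypothesis I_ss : contained_in I strictly_singular.
Let A : algType R[i] := bop X X.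
Let J := op_ideal_at I_ss X.
Hypothesis split : splits_algebraically (quot_pi J).

(* T differs by a matrix over the ideal from the invertible matrix
   V = theta (pi T) + 1 - theta (pi 1); the last two terms are there because
   theta need not be unital. *)
Lemma split_left_inverse N (S T : 'M[A]_N) : (0 < N)%N ->
  S *m T = 1%:M -> (forall i j, I X X ((1%:M - T *m S) i j)) -> T *m S = 1%:M.
Proof.
move=> N0 ST IST; have [theta [thetaM thetaK]] := split.
(* The composite theta o pi is multiplicative, vanishes on I(X) and moves each operator by an
   element of I(X). *)
pose ph (a : A) : A := theta (quot_pi J a).
have ph0 a : I X X a -> ph a = 0.
  move=> Ia; rewrite /ph (_ : quot_pi J a = 0) ?linear0//.
  by rewrite -(raddf0 (quot_pi J)); apply/quot_piP; rewrite subr0.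
have phM a b : ph (a * b) = ph a * ph b by rewrite /ph rmorphM thetaM.
have phB a b : ph (a - b) = ph a - ph b by rewrite /ph !raddfB.
have phI a : I X X (a - ph a).
  by apply/(@quot_piP _ _ J); rewrite /ph thetaK.
have phsum (r : seq 'I_N) F : ph (\sum_(i <- r) F i) = \sum_(i <- r) ph (F i).
  by rewrite /ph !raddf_sum.
pose Ph (M : 'M[A]_N) : 'M[A]_N := map_mx ph M.
have PhM M M' : Ph (M *m M') = Ph M *m Ph M'.
  apply/matrixP => i j; rewrite !mxE phsum; apply: eq_bigr => k _.
  by rewrite !mxE phM.
pose E := Ph 1%:M.
have PhTS : Ph T *m Ph S = E.
  rewrite -PhM; apply/esym/eqP; rewrite -subr_eq0; apply/eqP/matrixP => i j.
  by rewrite mxE [X in _ + X]mxE [X in _ - X]mxE [X in X - _]mxE -phB ph0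
    ?mxE//;
    have := IST i j; rewrite !mxE.
have PhST : Ph S *m Ph T = E by rewrite -PhM ST.
have EPh M : E *m Ph M = Ph M by rewrite -PhM mul1mx.
have PhE M : Ph M *m E = Ph M by rewrite -PhM mulmx1.
pose V := Ph T + (1%:M - E); pose V' := Ph S + (1%:M - E).
have inv M M' : Ph M *m Ph M' = E ->
    (Ph M + (1%:M - E)) *m (Ph M' + (1%:M - E)) = 1%:M.
  move=> MM'; rewrite mulmxDl !mulmxDr MM' !mulmxN !mulmx1 !mulmxBl !mul1mx.
  by rewrite PhE !EPh !subrr addr0 add0r subr0 addrC subrK.
have V'V : V' *m V = 1%:M := inv _ _ PhST.
have VV' : V *m V' = 1%:M := inv _ _ PhTS.
pose K := V' *m (T - V).
have TE : 1%:M + K = V' *m T by rewrite /K mulmxBr V'V addrC subrK.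
have IB a b : I X X a -> I X X b -> I X X (a - b).
  by move=> Ia Ib; rewrite addrC -scaleN1r; apply: (op_ideal_subspace I X X).2.
have IK i j : I X X (K i j).
  rewrite mxE; apply: op_ideal_sum => k; apply: (@op_ideal_mull _ I).
  have -> : (T - V) k j = (T k j - ph (T k j)) -
      ((1%:M : 'M[A]_N) k j - ph ((1%:M : 'M[A]_N) k j)).
    by rewrite !mxE opprD addrA.
  exact: IB.
(* Here 1 + K = V' T, and S V is its left inverse because V V' = 1 and S T = 1. It is then a right
   inverse as well, and conjugating V' T S V = 1 by V gives T S = 1. *)
have := @mx_left_inverse _ _ _ N0 I K (S *m V) I_ss IK.
rewrite TE mulmxA -(mulmxA S) VV' mulmx1 ST => /(_ erefl) h.
have : V *m (V' *m T *m (S *m V)) *m V' = V *m V' by rewrite h mulmx1.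
by rewrite !mulmxA VV' mul1mx -!mulmxA VV' mulmx1.
Qed.

End Splitting.

(** * The class of a rank-one idempotent *)

Section FiniteRankIdeal.
Context {R : realType} (X : banach R) (I : op_ideal R).
Hypothesis I_nonzero : nonzero_op_ideal I.
Local Open Scope complex_scope.

Lemma nonzero_op_ideal_point :
  exists2 S : bop X X, I X X S & exists x, S x <> 0.
Proof.
apply: contrapT => H; apply: (I_nonzero (X := X) (Y := X)).
apply/seteqP; split=> [S IS|_ ->]; last exact: (op_ideal_subspace I X X).1.
apply: bopP => x; apply: contrapT => Sx; apply: H; exists S => //.
by exists x => Sx0; apply: Sx; rewrite Sx0.
Qed.

(** With g(S x0) = 1, the operator factors through [S] as x -> f(x) x0 -> f(x) S x0 -> f(x) y. *)
Lemma rank_one_ideal (f : bop X R[i]^o) (y : X) (G : bop X X) :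
  (forall x, G x = (f x : R[i]) *: y) -> I X X G.
Proof.
move=> GE; have [S IS [x0 Sx0]] := nonzero_op_ideal_point.
have [g gS] := norming_functional Sx0.
have [T TE] := rank_one_bop f x0; have [U UE] := rank_one_bop g y.
have -> : G = bop_comp (bop_comp U S) T; last exact: op_ideal_comp.
apply: bopP => x; rewrite GE /= TE linearZ /= linearZ /= UE gS.
by rewrite scale1r.
Qed.

Lemma finite_rank_ideal (G : bop X X) : finite_rank G -> I X X G.
Proof.
move=> [s GE].
have [F FE] := choice (fun p : bop X R[i]^o * X => rank_one_bop p.1 p.2).
have -> : G = \sum_(p <- s) F p.
  by apply: bopP => x; rewrite GE bop_sumE; apply: eq_bigr => p _; rewrite FE.
by apply: op_ideal_sum => p; apply: rank_one_ideal (FE p).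
Qed.

Lemma rank_one_idempotent :
  exists F : bop X X, [/\ I X X F, F * F = F & F <> 0].
Proof.
have [S IS [x Sx]] := nonzero_op_ideal_point.
have [f fS] := norming_functional Sx.
have [F FE] := rank_one_bop f (S x); exists F; split.
- exact: rank_one_ideal FE.
- apply: bopP => z; rewrite -[(F * F) z]/(F (F z)) !FE linearZ /= fS.
  by congr (_ *: _); exact: mulr1.
- by move=> F0; apply: Sx;
  rewrite -[RHS]/((0 : bop X X) (S x)) -F0 FE fS scale1r.
Qed.

End FiniteRankIdeal.

Section ScalarIdempotents.
Context {A : pzRingType}.

Lemma scalar_idemP n (F : A) : F * F = F -> F%:M *m F%:M = F%:M :> 'M[A]_n.
Proof. by move=> FF; rewrite -scalar_mxM FF. Qed.

Definition scalar_idem n (F : A) (FF : F * F = F) : idem A :=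
  @Idem A n.+1 F%:M (ltn0Sn n) (scalar_idemP n.+1 FF).

Lemma scalar_idem_mulrn n (F : A) (FF : F * F = F) :
  idem_pi (scalar_idem 0 FF) *+ n.+1 = idem_pi (scalar_idem n FF).
Proof.
elim: n => [|n IH]; first by rewrite mulr1n.
rewrite mulrS IH; apply: etrans (idem_piD _ _) _.
apply: (@idem_pi_cast _ (idem_diag (scalar_idem 0 FF) (scalar_idem n FF))
  (scalar_idem n.+1 FF) erefl); rewrite castmx_id /=.
exact: (esym (@scalar_mx_block _ 1 n.+1 F)).
Qed.

Lemma idem_complP (Q : idem A) :
  (1%:M - idem_mx Q) *m (1%:M - idem_mx Q) = 1%:M - idem_mx Q.
Proof.
by rewrite mulmxBl mul1mx mulmxBr mulmx1 idem_mxP subrr subr0.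
Qed.

Definition idem_compl (Q : idem A) : idem A :=
  Idem (idem_size_gt0 Q) (idem_complP Q).

Definition idem_one n (n0 : (0 < n)%N) : idem A := @Idem A n 1%:M n0 (mul1mx _).

Lemma idem_piC (Q : idem A) :
  idem_pi Q + idem_pi (idem_compl Q) = idem_pi (idem_one (idem_size_gt0 Q)).
Proof.
apply: etrans (idem_piD _ _) _; apply/idem_piP => /=.
exists (col_mx (idem_mx Q) (1%:M - idem_mx Q)),
  (row_mx (idem_mx Q) (1%:M - idem_mx Q)).
rewrite mul_col_row mul_row_col idem_complP idem_mxP.
split; first by rewrite mulmxBr mulmx1 mulmxBl mul1mx idem_mxP subrr.
by rewrite [RHS]addrC subrK.
Qed.

Definition K0_class (P : idem A) : K0 A := groth_pi (idem_pi P, 0).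

Lemma K0_class_scalar n (F : A) (FF : F * F = F) :
  K0_class (scalar_idem 0 FF) *+ n.+1 = K0_class (scalar_idem n FF).
Proof.
have D (a b : idem_class A) :
    groth_pi (a, 0) + groth_pi (b, 0) = groth_pi (a + b, 0) :> K0 A.
  rewrite -[LHS]/(groth_add (groth_pi (a, 0)) (groth_pi (b, 0))) groth_piD.
  by rewrite -[LHS]/(groth_pi (a + b, 0 + 0)) addr0.
rewrite /K0_class -(scalar_idem_mulrn n).
elim: n => [|n IH]; first by rewrite !mulr1n.
by rewrite mulrS IH D [in RHS]mulrS.
Qed.

(** Vanishing in the Grothendieck group gives [P] + k = k for some class k; adding the complement of
    a representative of k replaces k by the class of an identity matrix. *)
Lemma K0_class_eq0 (P : idem A) : K0_class P = 0 ->
  exists n (n0 : (0 < n)%N),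
    idem_pi (idem_diag P (idem_one n0)) = idem_pi (idem_one n0).
Proof.
move=> /groth_piP[k]; rewrite /= addr0 add0r.
rewrite -(idem_pi_repr k); set Q := repr k => PQ.
exists (idem_size Q), (idem_size_gt0 Q).
rewrite -idem_piD -idem_piC.
change (idem_pi P + (idem_pi Q + idem_pi (idem_compl Q)) =
  idem_pi Q + idem_pi (idem_compl Q)).
by rewrite addrA PQ add0r.
Qed.

End ScalarIdempotents.

Section InfiniteOrder.
Context {R : realType} (X : banach R) (I : op_ideal R).
Hypothesis I_ss : contained_in I strictly_singular.
Hypothesis I_nonzero : nonzero_op_ideal I.
Hypothesis split : splits_algebraically (quot_pi (op_ideal_at I_ss X)).

(** If a multiple of the class vanished, diag(F, ..., F, 1) would be equivalent to 1. Cutting the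
    two witnesses into blocks gives R2 T2 = 1 and 1 - T2 R2 = T1 R1, which factors through copies of
    F and so has entries in I. The splitting forces T1 R1 = 0, while R1 T1 is the scalar matrix of
    F, so F = F F = 0. *)
Lemma rank_one_class_infinite_order :
  exists x : K0 (bop X X), forall n, x *+ n.+1 <> 0.
Proof.
have [F [IF FF /eqP F0]] := rank_one_idempotent X I_nonzero.
exists (K0_class (scalar_idem 0 FF)) => n.
rewrite K0_class_scalar => /K0_class_eq0[q [q0 /idem_piP[/= U [W []]]]].
rewrite -[U]vsubmxK -[W]hsubmxK mul_col_row mul_row_col.
set R1 := usubmx U; set R2 := dsubmx U; set T1 := lsubmx W; set T2 := rsubmx W.
move=> /eq_block_mx[RT1 _ _ RT2] /esym TR.
have T1R1 : T1 *m R1 = 1%:M - T2 *m R2 by rewrite -TR addrK.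
have T1R1E : T1 *m R1 = T1 *m F%:M *m R1.
  rewrite RT1 !mulmxA -mulmxA T1R1 mulmxBl mul1mx mulmxBr mulmx1.
  by rewrite !mulmxA -(mulmxA T2 R2 T2) -RT2 mulmx1 subrr subr0.
have T2R2 : T2 *m R2 = 1%:M.
  apply: (split_left_inverse split q0) => [|i j]; first by rewrite RT2.
  rewrite -T1R1 T1R1E mxE; apply: op_ideal_sum => k; apply: op_ideal_mulr.
  rewrite mxE; apply: op_ideal_sum => l; apply: op_ideal_mull.
  by rewrite mxE; case: eqP => // _; exact: (op_ideal_subspace I X X).1.
move: T1R1; rewrite T2R2 subrr => T1R1.
have : F%:M *m F%:M = 0 :> 'M[bop X X]_n.+1.
  by rewrite RT1 mulmxA -(mulmxA R1) T1R1 mulmx0 mul0mx.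
rewrite -scalar_mxM FF => /matrixP/(_ 0 0); rewrite !mxE eqxx mulr1n => F00.
by case/eqP: F0.
Qed.

Lemma split_K0_Z : has_subgroup_isomorphic_to_Z (K0 (bop X X)).
Proof.
have [x x_inf] := rank_one_class_infinite_order.
exists (range (fun z : int => x *~ z)); split.
- by exists 0; rewrite ?mulr0z.
- by move=> _ _ [a _ <-] [b _ <-]; exists (a - b); rewrite ?mulrzBr.
exists (intmul x : {additive int -> K0 (bop X X)}); split.
- by move=> z _; exists z.
- move=> a b _ _ /eqP; rewrite -subr_eq0 -mulrzBr => /eqP ab.
  apply/eqP; rewrite -subr_eq0; apply: contrapT => /negP ab0; move: ab.
  case: (a - b) ab0 => [[|n]|n] // _; first exact: x_inf.
  by rewrite NegzE mulrNz => /eqP; rewrite oppr_eq0 => /eqP; exact: x_inf.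
- by [].
Qed.

Lemma split_K0_neq0 : ~ forall x : K0 (bop X X), x = 0.
Proof.
move=> H; have [x /(_ 0%N)] := rank_one_class_infinite_order.
by apply; exact: H.
Qed.

End InfiniteOrder.

(** * Fredholm operators *)

Section Parametrix.
Context {R : realType} {Z : normedModType R[i]}.
Local Open Scope complex_scope.

Lemma finite_sum_bop n (f : 'I_n -> bop Z R[i]^o) (y : 'I_n -> Z) :
  exists G : bop Z Z, forall z, G z = \sum_i (f i z : R[i]) *: y i.
Proof.
have [F FE] := choice (fun i => rank_one_bop (f i) (y i)).
by exists (\sum_i F i) => z; rewrite bop_sumE; apply: eq_bigr => i _;
  rewrite FE.
Qed.

(** Subtracting from the new vector its components along the others leaves z <> 0. A functional h
    with h z = 1, corrected to vanish on the other vectors, is dual to the new one; the old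
    functionals are then corrected to vanish on the new vector. *)
Lemma biorthogonal n (x : 'I_n -> Z) :
  (forall w : 'I_n -> R[i], \sum_i w i *: x i = 0 -> forall i, w i = 0) ->
  exists g : 'I_n -> bop Z R[i]^o, forall i j, g i (x j) = (i == j)%:R.
Proof.
elim: n x => [|n IH] x xfree; first by exists (fun=> 0) => -[].
have [w w0 i|g gx] := IH (fun j => x (lift ord0 j)).
  have := xfree (fun k => if unlift ord0 k is Some j then w j else 0).
  rewrite big_ord_recl unlift_none scale0r add0r.
  under eq_bigr => j _ do rewrite liftK.
  by move=> /(_ w0 (lift ord0 i)); rewrite liftK.
pose z := x ord0 - \sum_j (g j (x ord0) : R[i]) *: x (lift ord0 j).
have z0 : z <> 0.
  move=> zE; have := xfree (fun k =>
    if unlift ord0 k is Some j then - (g j (x ord0) : R[i]) else 1).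
  rewrite big_ord_recl unlift_none scale1r.
  under eq_bigr => j _ do rewrite liftK scaleNr.
  rewrite sumrN => /(_ zE ord0) /eqP; rewrite unlift_none.
  by rewrite oner_eq0.
have [h hz] := norming_functional z0.
pose g0 : bop Z R[i]^o := h - \sum_j (h (x (lift ord0 j)) : R[i]) *: g j.
have g0E u : g0 u = h u - \sum_j h (x (lift ord0 j)) * g j u.
  rewrite -[LHS]/(h u - (\sum_j (h (x (lift ord0 j)) :
    R[i]) *: g j) u) bop_sumE.
  by [].
have g0x0 : g0 (x ord0) = 1.
  rewrite g0E -[RHS]hz [RHS]linearB [in RHS]linear_sum.
  apply: (congr1 (fun u : R[i] => h (x ord0) - u)).
  by apply: eq_bigr => j _; rewrite linearZ; exact: mulrC.
have g0x j : g0 (x (lift ord0 j)) = 0.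
  rewrite g0E (bigD1 j)//= gx eqxx mulr1 big1 ?addr0 ?subrr// => k /negbTE kj.
  by rewrite gx kj mulr0.
exists (fun i =>
  if unlift ord0 i is Some j then g j - (g j (x ord0) : R[i]) *: g0 else g0).
move=> i k; case: (unliftP ord0 i) => [j ->|->];
  case: (unliftP ord0 k) => [l ->|->].
- rewrite -[LHS]/(g j (x (lift ord0 l)) - g j (x ord0) * g0 (x (lift ord0 l))).
  by rewrite g0x mulr0 subr0 gx (inj_eq lift_inj).
- rewrite -[LHS]/(g j (x ord0) - g j (x ord0) * g0 (x ord0)) g0x0 mulr1 subrr.
  by rewrite eq_sym -[_ == _]negbK neq_lift.
- by rewrite g0x -[_ == _]negbK neq_lift.
- by rewrite g0x0 eqxx.
Qed.

(** 1 - S T and 1 - T S are finite-rank projections, onto the kernel of T and onto a complement of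
    its range. The conditions are symmetric under exchanging T, x, g with S, y, h, which reverses
    the sign of the index. *)
Record parametrix a b (T S : bop Z Z) (x : 'I_a -> Z) (g : 'I_a -> bop Z R[i]^o)
    (y : 'I_b -> Z) (h : 'I_b -> bop Z R[i]^o) : Prop := Parametrix {
  parametrix_l : forall z, S (T z) = z - \sum_i (g i z : R[i]) *: x i;
  parametrix_r : forall z, T (S z) = z - \sum_i (h i z : R[i]) *: y i;
  parametrix_gx : forall i j, g i (x j) = (i == j)%:R;
  parametrix_hy : forall i j, h i (y j) = (i == j)%:R;
  parametrix_Tx : forall i, T (x i) = 0;
  parametrix_Sy : forall j, S (y j) = 0;
  parametrix_gS : forall i z, g i (S z) = 0;
  parametrix_hT : forall j z, h j (T z) = 0 }.

Lemma parametrix_sym a b (T S : bop Z Z) x g y h :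
  @parametrix a b T S x g y h -> parametrix S T y h x g.
Proof. by case=> *; split. Qed.

(** Adjoining C^b, mapped onto the span of the y j, makes T surjective, so the open mapping theorem
    yields preimages under a norm bound without prior knowledge that the range of T is closed. *)
Lemma fredholm_parametrix (T : bop Z Z) a b : geo_complete Z ->
  has_dim (bop_ker T) a -> has_codim (range T) b ->
  exists S x g y h, @parametrix a b T S x g y h.
Proof.
move=> cZ [x [xker kx]] [y [_ yT]].
have Tx i : T (x i) = 0 by exact: xker.
have xfree (w : 'I_a -> R[i]) : \sum_i w i *: x i = 0 -> forall i, w i = 0.
  have [|c [_ cu]] := kx 0; first exact: linear0.
  move=> w0 i; have c0 : c = 0.
    by apply: cu; rewrite /= big1 ?subr0// => k _; rewrite mxE scale0r.
  have := cu (\row_k w k); rewrite c0 => cw.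
  have /rowP/(_ i) : 0 = \row_k w k.
    by apply: cw; rewrite /=; under eq_bigr => k _ do rewrite mxE;
      rewrite w0 subr0.
  by rewrite !mxE => <-.
have [g gx] := biorthogonal xfree.
have [P0 P0E] := finite_sum_bop g x.
have [Id IdE] : exists Id : bop Z Z, forall z, Id z = z.
  by apply: (@bop_of _ _ _ _ 1) => // z; rewrite mul1r.
have [P PE] : exists P : bop Z Z, forall z,
    P z = z - \sum_i (g i z : R[i]) *: x i.
  by exists (Id - P0) => z; rewrite -[LHS]/(Id z - P0 z) IdE P0E.
have Pker z : T z = 0 -> P z = 0.
  move=> /kx[c [/= /eqP cE _]]; move: cE; rewrite subr_eq0 => /eqP zE.
  rewrite PE; apply/eqP; rewrite subr_eq0 {1}zE; apply/eqP;
    apply: eq_bigr => i _.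
  rewrite zE linear_sum (bigD1 i)//= big1 ?addr0 => [|k /negbTE ki].
    by rewrite linearZ /= gx eqxx; congr (_ *: _);
      exact: (esym (mulr1 (c 0 i))).
  by rewrite linearZ /= gx eq_sym ki scaler0.
pose V : normedModType R[i] := (Z * power R[i]^o b)%type.
have [U UE] : exists U : bop V Z,
    forall p, U p = T p.1 + \sum_j (p.2 j : R[i]) *: y j.
  have [M M0 TM] := bop_bounded T.
  apply: (@bop_of _ _ _ _ (M + \sum_j rnorm (y j))) => [c p q|[z v] /=].
    rewrite /= linearP scalerDr addrACA scaler_sumr -big_split; congr (_ + _).
    by apply: eq_bigr => j _; rewrite !ffunE scalerDl scalerA.
  rewrite rnorm_pairE; apply: le_trans (rnormD _ _) _; rewrite mulrDl lerD//.
    by apply: le_trans (TM z) _; rewrite ler_pM2l// le_max lexx.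
  apply: le_trans (rnorm_sum _ _) _; rewrite mulr_suml; apply: ler_sum => j _.
  rewrite rnormZ mulrC ler_wpM2l ?rnorm_ge0// le_max; apply/orP; right.
  by rewrite rnorm_power (bigD1 j)//= lerDl sumr_ge0// => k _; exact: rnorm_ge0.
have [MU MU0 UM] := bop_bounded U.
have Usurj z : exists p, U p = z.
  have [c [[u _ /= uE] _]] := yT z I.
  exists ((u, [ffun j => c 0 j]) : V); rewrite UE /= uE.
  by rewrite -[RHS](subrK (\sum_j c 0 j *: y j)); congr (_ + _);
    apply: eq_bigr => j _; rewrite ffunE.
have cV : geo_complete V.
  exact: geo_complete_prod cZ (geo_complete_power _ geo_complete_scalars).
have [C C0 /choice[p pP]] : exists2 C : R, 0 < C & forall z, exists q : V,
    U q = z /\ rnorm q <= C * rnorm z.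
  have [C C0 CP] := open_mapping cV cZ UM Usurj.
  by exists C => // z; have [q ? ?] := CP z; exists q.
have Uinj q : U q = 0 -> T q.1 = 0 /\ q.2 = 0.
  rewrite UE => q0; have [c [_ cu]] := yT 0 I.
  have c0 : c = 0.
    by apply: cu; exists 0 => //; rewrite linear0 big1 ?subr0// => k _;
      rewrite mxE scale0r.
  have q2 : q.2 = 0.
    have /rowP qc : c = \row_j (q.2 j : R[i]).
      apply: cu; exists q.1 => //; rewrite sub0r.
      move: q0 => /eqP; rewrite addr_eq0 => /eqP ->; congr (- _).
      by apply: eq_bigr => j _; rewrite mxE.
    by apply/ffunP => j; have := qc j; rewrite c0 !mxE ffunE => <-.
  split=> //; move: q0; rewrite q2 big1 ?addr0// => j _.
  by rewrite ffunE scale0r.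
(* The selection [p] need not be linear, but two preimages differ by an element of ker T x 0.
   Projecting by [P] removes this ambiguity, so [S] and the [h j] are linear. *)
have Ueq q z : U q = z -> P (p z).1 = P q.1 /\ (p z).2 = q.2.
  move=> qz; have [|T0 q20] := Uinj (p z - q);
    first by rewrite linearB /= (pP z).1 qz subrr.
  split; apply/eqP; rewrite -subr_eq0; apply/eqP; last exact: q20.
  by rewrite -linearB; exact: Pker.
have Ulin c z z' : U (c *: p z + p z') = c *: z + z'.
  by rewrite linearP /= !(pP _).1.
have [MP MP0 PM] := bop_bounded P.
have [S SE] : exists S : bop Z Z, forall z, S z = P (p z).1.
  apply: (@bop_of _ _ _ _ (MP * C)) => [c z z'|z].
    by rewrite (Ueq _ _ (Ulin c z z')).1 linearP.
  apply: le_trans (PM _) _; rewrite -mulrA ler_pM2l//.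
  apply: le_trans (pP z).2; case: (p z) => u v; rewrite rnorm_pairE.
  by rewrite le_max lexx.
have /choice[h hE] : forall j,
    exists h : bop Z R[i]^o, forall z, h z = (p z).2 j.
  move=> j; apply: (@bop_of _ _ _ _ C) => [c z z'|z].
    by rewrite (Ueq _ _ (Ulin c z z')).2 !ffunE.
  apply: le_trans (pP z).2; case: (p z) => u v; rewrite rnorm_pairE /=.
  rewrite le_max; apply/orP; right.
  by rewrite rnorm_power (bigD1 j)//= lerDl sumr_ge0// => k _; exact: rnorm_ge0.
have UT z : U ((z, 0) : V) = T z.
  by rewrite UE /= big1 ?addr0// => j _; rewrite ffunE scale0r.
have Uy j : U ((0, [ffun k => (k == j)%:R]) : V) = y j.
  rewrite UE /= linear0 add0r (bigD1 j)//= ffunE eqxx scale1r big1 ?addr0//.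
  by move=> k /negbTE kj; rewrite ffunE kj scale0r.
have TP z : T (P z) = T z.
  rewrite PE linearB linear_sum big1 ?subr0// => i _.
  by rewrite linearZ /= Tx scaler0.
exists S, x, g, y, h; split=> //.
- by move=> z; rewrite SE (Ueq _ _ (UT z)).1 PE.
- move=> z; rewrite SE TP; under eq_bigr => j _ do rewrite hE.
  by apply/eqP; rewrite eq_sym subr_eq -UE (pP z).1.
- by move=> i j; rewrite hE (Ueq _ _ (Uy j)).2 ffunE.
- by move=> j; rewrite SE (Ueq _ _ (Uy j)).1 linear0.
- move=> i z; rewrite SE PE linearB linear_sum (bigD1 i)//= big1 => [|k /negbTE
  ki].
    by rewrite linearZ /= gx eqxx addr0; apply/eqP; rewrite subr_eq0;
      apply/eqP; exact: (esym (mulr1 (g i _))).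
  by rewrite linearZ /= gx eq_sym ki scaler0.
- by move=> j z; rewrite hE (Ueq _ _ (UT z)).2 ffunE.
Qed.

(* Adding to T an isomorphism of its kernel onto part of the complement of its
   range makes T left invertible. *)
Lemma parametrix_homeomorphic a d (T S : bop Z Z) x g y h :
  @parametrix a (a + d.+1) T S x g y h -> exists W : set Z,
  [/\ linear_subspace W, closed W, W <> [set: Z], finite_codim W &
      linearly_homeomorphic_onto Z W].
Proof.
move=> [ST TS gx hy Tx Sy gS hT].
(* The first a of the complementary vectors receive the kernel of T; the remaining d + 1 span a
   complement of the range of T + G, which is therefore proper. *)
have [G GE] := finite_sum_bop g (fun i => y (lshift d.+1 i)).
have [H HE] := finite_sum_bop (fun i => h (lshift d.+1 i)) x.
pose T' : bop Z Z := T + G; pose S' : bop Z Z := S + H.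
have sum_delta n (c : 'I_n -> R[i]) (i : 'I_n) :
    \sum_k c k * (i == k)%:R = c i.
  rewrite (bigD1 i)//= eqxx mulr1 big1 ?addr0// => k /negbTE ki.
  by rewrite eq_sym ki mulr0.
have T'E z : T' z = T z + \sum_i (g i z : R[i]) *: y (lshift d.+1 i).
  by rewrite -GE.
have S'E z : S' z = S z + \sum_i (h (lshift d.+1 i) z : R[i]) *: x i.
  by rewrite -HE.
have hT' j z : h j (T' z) = \sum_i (g i z : R[i]) * (j == lshift d.+1 i)%:R.
  rewrite T'E linearD /= hT add0r linear_sum; apply: eq_bigr => i _.
  by rewrite linearZ /= hy.
have S'T' z : S' (T' z) = z.
  rewrite S'E [S (T' z)](_ : _ = S (T z)); last first.
    rewrite T'E linearD linear_sum /= big1 ?addr0// => i _.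
    by rewrite linearZ /= Sy scaler0.
  rewrite ST -[RHS](subrK (\sum_i (g i z : R[i]) *: x i)); congr (_ + _).
  apply: eq_bigr => i _; congr (_ *: _); rewrite hT'.
  under eq_bigr => k _ do rewrite eq_lshift.
  exact: sum_delta.
have T'S' z :
    T' (S' z) = z - \sum_k (h (rshift a k) z : R[i]) *: y (rshift a k).
  have TS' : T (S' z) = T (S z).
    rewrite S'E linearD linear_sum /= big1 ?addr0// => i _.
    by rewrite linearZ /= Tx scaler0.
  have gS' i : g i (S' z) = h (lshift d.+1 i) z.
    rewrite S'E linearD /= gS add0r linear_sum.
    under eq_bigr => k _ do rewrite linearZ /= gx.
    exact: sum_delta.
  rewrite T'E TS' TS; under [X in _ + X]eq_bigr => i _ do rewrite gS'.
  rewrite big_split_ord /= opprD addrA addrAC.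
  by rewrite -[RHS](subrK (\sum_i (h (lshift d.+1 i) z :
    R[i]) *: y (lshift d.+1 i))).
have rT' z : range T' z <-> z = T' (S' z).
  split=> [[u _ <-]|zE]; last by exists (S' z).
  by rewrite S'T'.
exists (range T'); split.
- split=> [|c _ _ [u _ <-] [v _ <-]]; first by exists 0; rewrite ?linear0.
  by exists (c *: u + v); rewrite ?linearP.
(* The range of [T'] is the kernel of the finite-rank projection 1 - T' S'. *)
- have [Q QE] := finite_sum_bop (fun k => h (rshift a k)) (fun k => y (rshift a
  k)).
  have -> : range T' = Q @^-1` [set 0].
    apply/seteqP; split=> [z /rT'|z /= Qz].
      by rewrite T'S' -QE => /eqP;
        rewrite eq_sym -subr_eq0 addrAC subrr add0r oppr_eq0 => /eqP.
    by apply/rT'; rewrite T'S' -QE Qz subr0.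
  apply: closed_comp; last first.
    exact/accessible_closed_set1/hausdorff_accessible/norm_hausdorff.
  by move=> z _; exact: bop_continuous.
- move=> WT; have [u _ uE] : range T' (y (rshift a ord0)) by rewrite WT.
  have := hy (rshift a ord0) (rshift a ord0).
  rewrite -uE hT' eqxx big1 => [/eqP|k _]; first by rewrite eq_sym oner_eq0.
  by rewrite eq_rlshift mulr0.
- exists d.+1, (fun k => y (rshift a k)); split=> // z _.
  exists (\row_k (h (rshift a k) z : R[i])); split.
    exists (S' z) => //; rewrite T'S'; congr (_ - _).
    by apply: eq_bigr => k _; rewrite mxE.
  move=> c [u _ uE]; apply/rowP => k; rewrite mxE.
  have := hT' (rshift a k) u; rewrite big1 => [|i _];
    last by rewrite eq_rlshift mulr0.
  rewrite uE linearB linear_sum /= => /eqP; rewrite subr_eq0 => /eqP ->.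
  under eq_bigr => i _ do rewrite linearZ /= hy eq_rshift.
  exact: sum_delta.
- exists T', S'; split=> //.
  by apply: continuous_subspaceT => z; exact: bop_continuous.
Qed.

Lemma fredholm_homeomorphic (T : bop Z Z) k : geo_complete Z ->
  fredholm_of_index T k -> k <> 0 -> exists W : set Z,
  [/\ linear_subspace W, closed W, W <> [set: Z], finite_codim W &
      linearly_homeomorphic_onto Z W].
Proof.
move=> cZ [a [b [da db ->]]] k0.
have [S [x [g [y [h D]]]]] := fredholm_parametrix cZ da db.
have [ab|ba|ab] := ltngtP a b; last by case: k0; rewrite ab subrr.
  move: y h D {db k0}; rewrite -(subnKC ab) addSnnS => y h.
  exact: parametrix_homeomorphic.
(* For positive index the parametrix [S] takes the place of [T]. *)
move: x g D {da k0}; rewrite -(subnKC ba) addSnnS => x g /parametrix_sym.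
exact: parametrix_homeomorphic.
Qed.

Lemma injective_has_dim_ker (T : bop Z Z) (S : Z -> Z) :
  cancel T S -> has_dim (bop_ker T) 0.
Proof.
move=> TS; exists (fun=> 0); split=> [[]//|u /= Tu]; exists 0; split.
  by rewrite /= big_ord0 subr0; apply: (can_inj TS); rewrite Tu linear0.
by move=> c _; apply/rowP => -[].
Qed.

Lemma proper_codim_gt0 (W : set Z) n :
  W <> [set: Z] -> has_codim W n -> (0 < n)%N.
Proof.
case: n => // WT [e [_ eW]]; case: WT; apply/seteqP; split=> // u _.
by have [c [+ _]] := eW u I; rewrite big_ord0 subr0.
Qed.

Lemma homeomorphic_fredholm (W : set Z) : W <> [set: Z] -> finite_codim W ->
  linearly_homeomorphic_onto Z W ->
  exists (T : bop Z Z) k, fredholm_of_index T k /\ k <> 0.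
Proof.
move=> WT [n Wn] [T [S [TW TS _]]]; have n0 := proper_codim_gt0 WT Wn.
exists T, (0%:Z - n%:Z); split.
  by exists 0%N, n; split=> //; [exact: injective_has_dim_ker TS | rewrite TW].
by move/eqP; rewrite sub0r oppr_eq0 gt_eqF.
Qed.

End Parametrix.

(** The inverse [S'] is continuous only on W; the parametrix replaces it by a bounded left inverse S
    on all of X^m. The defect 1 - T S has finite rank, so its matrix entries lie in I and the
    splitting forces it to vanish. But it fixes the vectors y i, which are non-zero since h i (y i)
    = 1. *)
Lemma homeomorphic_not_split (R : realType) (X : banach R) (I : op_ideal R)
    (I_nonzero : nonzero_op_ideal I) (I_ss : contained_in I strictly_singular)
    m (W : set (power X m)) : (0 < m)%N ->
  W <> [set: power X m] -> finite_codim W ->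
  linearly_homeomorphic_onto (power X m) W ->
  ~ splits_algebraically (quot_pi (op_ideal_at I_ss X)).
Proof.
move=> m0 WT [n Wn] [T [S' [TW TS' _]]] split.
have cZ : geo_complete (power X m) := geo_complete_banach _.
have n0 := proper_codim_gt0 WT Wn.
have [|S [x [g [y [h [ST TSr _ hy _ _ _ _]]]]]] :=
  @fredholm_parametrix _ _ T 0 n cZ (injective_has_dim_ker TS');
    first by rewrite TW.
pose Tm : 'M[bop X X]_m := mx_of_op T; pose Sm : 'M[bop X X]_m := mx_of_op S.
have ST1 : Sm *m Tm = 1%:M.
  apply: (@op_of_mx_inj _ X m m0); rewrite op_of_mxM op_of_mx1 !mx_of_opK.
  by apply: bopP => z; rewrite -[LHS]/(S (T z)) ST big_ord0 subr0.
have opTS z : op_of_mx m0 (1%:M - Tm *m Sm) z = \sum_i (h i z : R[i]) *: y i.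
  have -> : op_of_mx m0 (1%:M - Tm *m Sm) = 1 - op_of_mx m0 (Tm *m Sm).
    by apply/eqP; rewrite eq_sym subr_eq -op_of_mxD subrK op_of_mx1.
  rewrite op_of_mxM !mx_of_opK -[LHS]/(z - T (S z)) TSr opprB addrC subrK.
  by [].
have ITS i j : I X X ((1%:M - Tm *m Sm) i j).
  apply: (finite_rank_ideal I_nonzero).
  exists [seq (bop_comp (h k) (power_inj X j), y k i) | k <- enum 'I_n] => u.
  rewrite big_map big_enum /=.
  have := congr1 (fun z : power X m => z i) (opTS (power_inj X j u)).
  rewrite op_of_mxE (bigD1 j)//= big1 ?addr0 => [|k /negbTE kj].
    rewrite power_injE ffunE eqxx sum_ffunE => ->.
    by apply: eq_bigr => k _; rewrite ffunE.
  by rewrite power_injE ffunE kj linear0.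
have TS1 := split_left_inverse split m0 ST1 ITS.
have y0 : y (Ordinal n0) = 0.
  have := opTS (y (Ordinal n0)); rewrite TS1 subrr.
  rewrite (bigD1 (Ordinal n0))//= hy eqxx scale1r big1 ?addr0 => [<-|k /negbTE
    kn].
    by apply/ffunP => i; rewrite op_of_mxE ffunE big1// => j _; rewrite mxE.
  by rewrite hy kn scale0r.
have := hy (Ordinal n0) (Ordinal n0); rewrite y0 linear0 eqxx => /eqP.
by rewrite eq_sym oner_eq0.
Qed.

Theorem corollary4p3 (R : realType) (X : banach R) (I : op_ideal R)
    (I_closed : closed_op_ideal I) (I_nonzero : nonzero_op_ideal I)
    (I_ss : contained_in I strictly_singular) :
  let pi : bop X X -> quot_alg (op_ideal_at I_ss X) :=
    quot_pi (op_ideal_at I_ss X) in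
  let homeomorphic_to_proper_subspace :=
    exists2 m : nat, (0 < m)%N & exists W : set (power X m),
      [/\ linear_subspace W, closed W, W <> [set: power X m], finite_codim W &
          linearly_homeomorphic_onto (power X m) W] in
  let admits_fredholm_of_nonzero_index :=
    exists2 m : nat, (0 < m)%N &
      exists (T : bop (power X m) (power X m)) (k : int),
        fredholm_of_index T k /\ k <> 0 in
  [/\ splits_algebraically pi -> has_subgroup_isomorphic_to_Z (K0 (bop X X)),
      (forall x : K0 (bop X X), x = 0) -> ~ splits_algebraically pi,
      homeomorphic_to_proper_subspace <-> admits_fredholm_of_nonzero_index &
      homeomorphic_to_proper_subspace -> ~ splits_algebraically pi].
Proof.
move=> pi homeo fredholm; split.
- exact: split_K0_Z.
- by move=> K0 /(split_K0_neq0 I_nonzero).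
- split=> [[m m0 [W [_ _ WT Wfin Whom]]]|[m m0 [T [k [Tk k0]]]]]; exists m => //.
    exact: homeomorphic_fredholm Whom.
  exact: fredholm_homeomorphic (geo_complete_banach _) Tk k0.
- by move=> [m m0 [W [_ _ WT Wfin Whom]]]; exact: homeomorphic_not_split Whom.
Qed.
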